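(* Let $X$ be an arbitrary topological space and let $\mathcal A\colon X\to\mathcal R_K^1(H)$ be a Riesz continuous map. Suppose that $\mathcal A$ admits a $\mathrm{Cl}(1)$ spectral section $P$ with a cut-off function $r\colon X\to\mathbb R_+$. Then $\mathcal A$ admits an odd $r$-trivializing family $\mathcal C\colon X\to\mathcal B^1(H)$ that agrees with $P$ and satisfies $\|\mathcal C_x\|<2r_x$ for every $x\in X$.
   Context: $H=H^0\oplus H^1$ is a $\mathbb Z_2$-graded separable complex Hilbert space with $H^0,H^1$ both infinite-dimensional, and $\sigma=\begin{pmatrix}1&0\\0&-1\end{pmatrix}\in\mathcal B(H)$ is the symmetry defining the grading. An operator is odd if it anticommutes with $\sigma$. $\mathcal R_K^{\mathrm{sa}}(H)$ is the set of regular (closed densely defined) self-adjoint operators $A$ on $H$ with compact resolvents, i.e. with $(A+i)^{-1}$ compact; $\mathcal R_K^1(H)$ is its subset of odd operators. $\mathcal B^1(H)$ is the space of odd bounded self-adjoint operators with the norm topology. The bounded transform is $f(A)=A(1+A^*A)^{-1/2}$; the Riesz topology is induced by $f$ from the norm topology on $\mathcal B(H)$; Riesz continuous means continuous with respect to it. Projection means orthogonal projection. $\mathbb 1_S$ is the characteristic function of $S\subset\mathbb R$; $\mathbb R_+=(0,\infty)$. For a continuous function $r\colon X\to\mathbb R_+$, a spectral section for $\mathcal A=(\mathcal A_x)$ with cut-off function $r$ is a norm continuous family $P=(P_x)_{x\in X}$ of projections such that $\mathbb 1_{[r_x,+\infty)}(\mathcal A_x)\le P_x\le\mathbb 1_{(-r_x,+\infty)}(\mathcal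 A_x)$ for every $x\in X$. It is a $\mathrm{Cl}(1)$ spectral section if in addition $\sigma P_x\sigma^{-1}=1-P_x$ for every $x$. A self-adjoint operator $C$ of finite rank is an $r$-trivializing operator ($r>0$) for $A$ if $A+C$ is invertible and the range of $C$ lies in the range of $\mathbb 1_{(-r,r)}(A)$. For a continuous $r\colon X\to\mathbb R_+$, an $r$-trivializing family for $\mathcal A$ is a norm continuous family $\mathcal C=(\mathcal C_x)$ of self-adjoint operators such that $\mathcal C_x$ is an $r_x$-trivializing operator for $\mathcal A_x$ for every $x\in X$; it agrees with $P$ if $P_x=\mathbb 1_{[0,+\infty)}(\mathcal A_x+\mathcal C_x)$ for every $x\in X$. *)

(* Defs.v *)
From HB Require Import structures.
From mathcomp Require Import all_boot all_order all_algebra complex.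
From mathcomp Require Import all_classical all_reals all_analysis.

Set Implicit Arguments.
Unset Strict Implicit.
Unset Printing Implicit Defensive.
Import Order.TTheory GRing.Theory Num.Theory.
Import numFieldNormedType.Exports.
Local Open Scope classical_set_scope.
Local Open Scope ring_scope.

Section Hilbert.
Variables (R : realType) (H : completeNormedModType R[i]).

(* Together with completeness of H, this makes H a complex Hilbert space; the
   inner product is linear in its first argument. *)
Definition is_hilbert (dot : {dot H for Num.conj}) : Prop :=
  forall v : H, `|v| ^+ 2 = dot v v.

Definition separable_space : Prop := exists D : set H, countable D /\ dense D.

Definition linear_subspace (V : set H) : Prop :=
  V 0 /\ forall (a : R[i]) (v w : H), V v -> V w -> V (a *: v + w).

Definition finite_dimensional (V : set H) : Prop :=
  exists (n : nat) (e : 'I_n -> H),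
    forall v, V v -> exists c : 'I_n -> R[i], v = \sum_(i < n) c i *: e i.

Variable dot : {dot H for Num.conj}.

Record is_grading (H0 H1 : set H) (sigma : H -> H) : Prop := IsGrading {
  grading_subspace0 : linear_subspace H0;
  grading_subspace1 : linear_subspace H1;
  grading_closed0 : closed H0;
  grading_closed1 : closed H1;
  grading_orthogonal : forall v0 v1, H0 v0 -> H1 v1 -> dot v0 v1 = 0;
  grading_decomposition : forall v, exists v0 v1, [/\ H0 v0, H1 v1 & v = v0 + v1];
  grading_symmetry : forall v0 v1, H0 v0 -> H1 v1 -> sigma (v0 + v1) = v0 - v1 }.

(* Unbounded operators are represented by their graphs, as sets of pairs
   (v, A v) with v in the domain of A; equality of operators, which includes
   equality of domains, is then equality of sets.  Bounded operators are
   functions H -> H, and enter the calculus of unbounded ones through [graph]. *)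

Implicit Types (A B : set (H * H)) (T S C P Q : H -> H).

Definition is_operator A : Prop :=
  [/\ A (0, 0),
      forall (a : R[i]) v w v' w', A (v, w) -> A (v', w') ->
        A (a *: v + v', a *: w + w') &
      forall v w w', A (v, w) -> A (v, w') -> w = w'].

Definition dom A : set H := [set v | exists w, A (v, w)].

Definition graph T : set (H * H) := [set p | p.2 = T p.1].

Definition op_add A B : set (H * H) :=
  [set p | exists w w', [/\ A (p.1, w), B (p.1, w') & p.2 = w + w']].

Definition op_opp A : set (H * H) := [set p | A (p.1, - p.2)].

(* A after B *)
Definition op_comp A B : set (H * H) :=
  [set p | exists u, B (p.1, u) /\ A (u, p.2)].

Definition op_inv A : set (H * H) := [set p | A (p.2, p.1)].

Definition adjoint A : set (H * H) :=
  [set p | forall v w, A (v, w) -> dot w p.1 = dot v p.2].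

Definition self_adjoint A : Prop := adjoint A = A.

Definition regular A : Prop := [/\ is_operator A, closed A & dense (dom A)].

Definition bounded_op T : Prop := linear T /\ continuous T.

Definition compact_op T : Prop :=
  linear T /\ precompact (T @` [set v | `|v| <= 1]).

Definition invertible A : Prop :=
  exists2 T, bounded_op T & op_inv A = graph T.

Definition compact_resolvent A : Prop :=
  exists2 K, compact_op K &
    op_inv (op_add A (graph (fun v => 'i%C *: v))) = graph K.

Definition odd_op (sigma : H -> H) A : Prop :=
  op_comp A (graph sigma) = op_opp (op_comp (graph sigma) A).

Definition RKsa A : Prop :=
  [/\ regular A, self_adjoint A & compact_resolvent A].

Definition RK1 (sigma : H -> H) A : Prop := RKsa A /\ odd_op sigma A.

Definition B1 (sigma : H -> H) T : Prop :=
  [/\ bounded_op T, self_adjoint (graph T) & odd_op sigma (graph T)].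

Definition opnorm T : R :=
  sup [set complex.Re `|T v| | v in [set v | `|v| <= 1]].

Definition opnorm_continuous (X : topologicalType) (F : X -> H -> H) : Prop :=
  (forall x, bounded_op (F x)) /\
  forall x, opnorm (fun v => F y v - F x v) @[y --> x] --> 0.

(* F = A (1 + A^* A)^{-1/2}, where S = (1 + A^* A)^{-1/2} is the nonnegative
   square root of (1 + A^* A)^{-1}. *)
Definition is_bounded_transform A (F : H -> H) : Prop :=
  exists S,
    [/\ bounded_op S, self_adjoint (graph S), forall v, 0 <= dot (S v) v,
        graph (S \o S) =
          op_inv (op_add (graph id) (op_comp (adjoint A) A)) &
        graph F = op_comp A (graph S)].

(* The Riesz topology is the initial topology for the bounded transform. *)
Definition Riesz_continuous (X : topologicalType) (A : X -> set (H * H)) : Prop :=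
  exists2 F : X -> H -> H,
    forall x, is_bounded_transform (A x) (F x) & opnorm_continuous F.

Definition projection P : Prop :=
  [/\ bounded_op P, self_adjoint (graph P) & forall v, P (P v) = P v].

Definition op_le T S : Prop := forall v, dot (T v) v <= dot (S v) v.

(* E is the projection-valued measure, defined on the Borel subsets of R, with
   A = \int t dE(t).  The measures mu below are the S |-> <E(S) v, v>: the domain
   of A consists of those v for which t^2 is mu-integrable, and A is determined
   on it by its quadratic form <A v, v> = \int t dmu(t).
   The functional calculus is 1_S(A) = E S.  A self-adjoint operator has exactly
   one such E, up to the irrelevant values of E on non-Borel sets. *)
Definition is_spectral_measure A (E : set R -> H -> H) : Prop :=
  [/\ forall S : set R, measurable S -> projection (E S),
      forall v, E setT v = v &
      forall v, exists mu : {measure set (measurableTypeR R) -> \bar R},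
        [/\ forall S : set R, measurable S ->
              mu S = (complex.Re (dot (E S v) v))%:E,
            dom A v <-> (\int[mu]_t ((t : R) ^+ 2)%:E < +oo)%E &
            forall w, A (v, w) -> dot w v = (\int[mu]_t (t : R))%:C%C]].

Definition spectral_section (X : topologicalType) (A : X -> set (H * H))
    (r : X -> R) (P : X -> H -> H) : Prop :=
  [/\ opnorm_continuous P,
      forall x, projection (P x) &
      forall x, exists2 E, is_spectral_measure (A x) E &
        op_le (E `[r x, +oo[%classic) (P x) /\ op_le (P x) (E `]- r x, +oo[%classic)].

(* sigma is its own inverse. *)
Definition Cl1_spectral_section (sigma : H -> H) (X : topologicalType)
    (A : X -> set (H * H)) (r : X -> R) (P : X -> H -> H) : Prop :=
  spectral_section A r P /\
  forall x v, sigma (P x (sigma v)) = v - P x v.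

Definition trivializing (r : R) A C : Prop :=
  [/\ bounded_op C, self_adjoint (graph C), finite_dimensional (range C),
      invertible (op_add A (graph C)) &
      exists2 E, is_spectral_measure A E & range C `<=` range (E `]- r, r[%classic)].

Definition trivializing_family (X : topologicalType) (A : X -> set (H * H))
    (r : X -> R) (C : X -> H -> H) : Prop :=
  opnorm_continuous C /\ forall x, trivializing (r x) (A x) (C x).

Definition agrees_with (X : topologicalType) (A : X -> set (H * H))
    (C P : X -> H -> H) : Prop :=
  forall x, exists2 E, is_spectral_measure (op_add (A x) (graph (C x))) E &
    P x = E `[0, +oo[%classic.

End Hilbert.

(* Main.v *)
Require Import Defs.
From HB Require Import structures.
From mathcomp Require Import all_boot all_order all_algebra complex.
From mathcomp Require Import all_classical all_reals all_analysis.
From mathcomp Require Import measurable_realfun ring lra.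

Set Implicit Arguments.
Unset Strict Implicit.
Unset Printing Implicit Defensive.
Import Order.TTheory GRing.Theory Num.Theory.
Import numFieldNormedType.Exports.
Local Open Scope classical_set_scope.
Local Open Scope ring_scope.

(** For a single operator A with projection P put V = ran 1_(-r,r)(A), which is
    finite-dimensional because A has compact resolvent.  P is 1 on
    ran 1_[r,oo)(A), 0 on ran 1_(-oo,-r](A), and preserves V.  Let C be 0 on the
    orthogonal complement of V and r (2P - 1) - A on V.  Then A + C equals A off
    V and r (2P - 1) on V, so it is invertible and its nonnegative spectral
    projection is P; the strict bound holds because A has finitely many
    eigenvalues in (-r,r).

    Globally C = r (2P - 1) - clamp_r(A), where clamp_r truncates to [-r,r].
    Finite sums of eigenvectors are dense, so bounded operators can be compared
    on eigenvectors; there clamp_r(A) is a continuous function of the bounded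
    transform of A, hence a uniform limit of its Bernstein polynomials, and is
    therefore norm continuous.  Oddness of C is also checked on eigenvectors. *)

(** * The underlying real inner product space *)

(** The obstacle is continuity. The projection onto V may jump in x when an eigenvalue crosses r or
    -r, so the description of C through V does not show that C varies continuously. In the global
    formula V has disappeared: off V both r (2P - 1) and clamp_r(A) are r on the positive side and
    -r on the negative side, so they cancel, and each of the two terms is norm continuous
    separately. P commutes with the projection onto V, but is not known to commute with A on V; this
    is why C removes A from V altogether and puts a multiple of the reflection 2P - 1 in its place.

    A spectral measure is given only by projections, by the scalar measures of vectors and by their
    first and second moments. Multiplicativity of E, invariance of its ranges under A, and norm
    bounds for A on these ranges therefore have to be extracted from quadratic forms. The calculus
    of functions of A is never built: only its values on eigenvectors are needed. *)

Section RealStructure.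
Variables (R : realType) (H : completeNormedModType R[i]) (dot : {dot H for Num.conj}).
Hypothesis hH : is_hilbert dot.

Definition rdot (u v : H) : R := complex.Re (dot u v).
Definition rnorm (v : H) : R := complex.Re `|v|.

Lemma ReD (x y : R[i]) : complex.Re (x + y) = complex.Re x + complex.Re y.
Proof. by case: x => a b; case: y. Qed.

Lemma ReN (x : R[i]) : complex.Re (- x) = - complex.Re x.
Proof. by case: x. Qed.

Lemma dot_conj u v : dot u v = (dot v u)^*%C.
Proof. by rewrite hermC expr0 mul1r. Qed.

Lemma rdotC u v : rdot u v = rdot v u.
Proof. by rewrite /rdot dot_conj; case: (dot v u). Qed.

Lemma rdotDl u v w : rdot (u + v) w = rdot u w + rdot v w.
Proof. by rewrite /rdot linearDl ReD. Qed.

Lemma rdotZl (a : R) u v : rdot (a%:C%C *: u) v = a * rdot u v.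
Proof. by rewrite /rdot linearZl_LR /=; case: (dot u v) => x y /=; rewrite mul0r subr0. Qed.

Lemma rdotDr u v w : rdot u (v + w) = rdot u v + rdot u w.
Proof. by rewrite rdotC rdotDl !(rdotC u). Qed.

Lemma rdotZr (a : R) u v : rdot u (a%:C%C *: v) = a * rdot u v.
Proof. by rewrite rdotC rdotZl rdotC. Qed.

Lemma rdotNl u v : rdot (- u) v = - rdot u v.
Proof. by rewrite /rdot linearNl ReN. Qed.

Lemma rdotNr u v : rdot u (- v) = - rdot u v.
Proof. by rewrite rdotC rdotNl rdotC. Qed.

Lemma rdotBl u v w : rdot (u - v) w = rdot u w - rdot v w.
Proof. by rewrite rdotDl rdotNl. Qed.

Lemma rdotBr u v w : rdot u (v - w) = rdot u v - rdot u w.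
Proof. by rewrite rdotDr rdotNr. Qed.

Lemma rdot0l u : rdot 0 u = 0.
Proof. by rewrite /rdot linear0l. Qed.

Lemma rdot0r u : rdot u 0 = 0.
Proof. by rewrite rdotC rdot0l. Qed.

Lemma Im_dot u v : complex.Im (dot u v) = rdot u ('i%C *: v).
Proof.
rewrite /rdot linearZr_LR /=; case: (dot u v) => x y /=.
by rewrite mul0r mulN1r opprK add0r.
Qed.

Lemma dotE u v : dot u v = (rdot u v +i* rdot u ('i%C *: v))%C.
Proof. by rewrite -Im_dot /rdot; case: (dot u v). Qed.

(** a = 1 compares the real parts and a = ['i] the imaginary parts. This is how identities proved
    for [rdot] are carried back to [dot]. *)
Lemma eq_dot_rdot u v u' v' : (forall a : R[i], rdot (a *: u) v = rdot (a *: u') v') ->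
  dot u v = dot u' v'.
Proof.
have rdi (a b : H) : rdot ('i%C *: a) b = - complex.Im (dot a b).
  by rewrite /rdot linearZl_LR /=; case: (dot a b) => x y; simpc.
move=> h; have := h 1; have := h 'i%C; rewrite !scale1r !rdi => /oppr_inj h1 h2.
by rewrite !dotE -!Im_dot h1 h2.
Qed.

Lemma normr_rnorm v : `|v| = (rnorm v)%:C%C.
Proof. by rewrite RRe_real // normr_real. Qed.

Lemma rnorm_ge0 v : 0 <= rnorm v.
Proof. by rewrite -(lecR 0) -normr_rnorm normr_ge0. Qed.

Lemma rnorm2 v : rnorm v ^+ 2 = rdot v v.
Proof. by rewrite /rdot -hH normr_rnorm -rmorphXn. Qed.

Lemma rdot_ge0 v : 0 <= rdot v v. Proof. by rewrite -rnorm2 sqr_ge0. Qed.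

Lemma rnorm0 : rnorm 0 = 0. Proof. by rewrite /rnorm normr0. Qed.

Lemma rnorm_eq0 v : rnorm v = 0 -> v = 0.
Proof. by move=> h; apply/eqP; rewrite -normr_eq0 normr_rnorm h. Qed.

Lemma rdot_eq0 v : rdot v v = 0 -> v = 0.
Proof. by rewrite -rnorm2 => /eqP; rewrite sqrf_eq0 => /eqP /rnorm_eq0. Qed.

Lemma rnormD u v : rnorm (u + v) <= rnorm u + rnorm v.
Proof. by rewrite -lecR rmorphD /= -!normr_rnorm ler_normD. Qed.

Lemma rnormN v : rnorm (- v) = rnorm v. Proof. by rewrite /rnorm normrN. Qed.

Lemma rnormB u v : rnorm (u - v) <= rnorm u + rnorm v.
Proof. by rewrite -(rnormN v) rnormD. Qed.

Lemma rnormC u v : rnorm (u - v) = rnorm (v - u).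
Proof. by rewrite -rnormN opprB. Qed.

Lemma rnorm_tri w u v : rnorm (u - v) <= rnorm (u - w) + rnorm (w - v).
Proof. by rewrite (le_trans _ (rnormD _ _))// addrA subrK. Qed.

Lemma rnormZ (a : R[i]) v : rnorm (a *: v) = complex.Re `|a| * rnorm v.
Proof.
by rewrite {1}/rnorm normrZ normr_rnorm normc_def /= mul0r subr0.
Qed.

Lemma rnormZr (a : R) v : rnorm (a%:C%C *: v) = `|a| * rnorm v.
Proof. by rewrite rnormZ normc_def /= expr0n /= addr0 sqrtr_sqr. Qed.

Lemma rnorm_sqr_le u v : (rnorm u <= rnorm v) = (rdot u u <= rdot v v).
Proof. by rewrite -!rnorm2 ler_pXn2r// nnegrE rnorm_ge0. Qed.

Lemma rnormD2 u v : rdot (u + v) (u + v) = rdot u u + rdot v v + 2 * rdot u v.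
Proof. rewrite !rdotDl !rdotDr (rdotC v u); ring. Qed.

Lemma rnorm_le (M : R) u : 0 <= M -> (rnorm u <= M) = (rdot u u <= M ^+ 2).
Proof. by move=> M0; rewrite -rnorm2 ler_pXn2r// nnegrE rnorm_ge0. Qed.

(** The triangle inequality comes with the norm of H; squaring it gives Cauchy-Schwarz. *)
Lemma rdot_CS u v : rdot u v <= rnorm u * rnorm v.
Proof.
have := rnormD u v; rewrite rnorm_le ?addr_ge0 ?rnorm_ge0// rnormD2 sqrrD !rnorm2.
by rewrite mulr2n; lra.
Qed.

End RealStructure.

(** * Bounded operators *)

Section Topology.
Variables (R : realType) (H : completeNormedModType R[i]).
Implicit Types (u v w : H) (T : H -> H).

(** The norm of H takes values in [R[i]], but a positive radius there is real, so real radii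
    describe the same topology. *)
Lemma nbhs_nrP v (W : set H) :
  nbhs v W <-> exists2 e : R, 0 < e & forall u, rnorm (v - u) < e -> W u.
Proof.
split => [/nbhs_ballP[e /= e0 eW]|[e e0 eW]].
  have eE : e = (complex.Re e)%:C%C by rewrite RRe_real// gtr0_real.
  exists (complex.Re e); first by rewrite -ltcR -eE.
  by move=> u uv; apply: eW; rewrite -ball_normE /= normr_rnorm eE ltcR.
apply/nbhs_ballP; exists e%:C%C; first by rewrite /= ltcR.
by move=> u; rewrite -ball_normE /= normr_rnorm ltcR; exact: eW.
Qed.

Lemma dense_nr (D : set H) : dense D -> forall v (e : R), 0 < e ->
  exists2 u, D u & rnorm (v - u) < e.
Proof.
move=> dD v e e0; have [] := dD (ball v e%:C%C).
- by exists v; apply: ballxx; rewrite ltcR.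
- by apply: ball_open; rewrite ltcR.
- by move=> u [+ Du]; rewrite -ball_normE /= normr_rnorm ltcR; exists u.
Qed.

Lemma closed_graph_nr (A : set (H * H)) : closed A -> forall v v',
  (forall e : R, 0 < e -> exists u w, [/\ A (u, w), rnorm (v - u) < e & rnorm (v' - w) < e]) ->
  A (v, v').
Proof.
move=> cA v v' h; apply: cA => /= B [[B1 B2] [/= /nbhs_nrP[e1 e10 h1] /nbhs_nrP[e2 e20 h2]] sB].
have [|u [w [Auw ue we]]] := h (Num.min e1 e2); first by rewrite lt_min e10.
exists (u, w); split => //; apply: sB; split => /=.
  by apply: h1; rewrite (lt_le_trans ue)// ge_min lexx.
by apply: h2; rewrite (lt_le_trans we)// ge_min lexx orbT.
Qed.

Lemma cauchy_nr (u : nat -> H) :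
  (forall e : R, 0 < e -> exists N, forall m n, (N <= m)%N -> (N <= n)%N -> rnorm (u m - u n) < e) ->
  exists l, forall e : R, 0 < e -> exists N, forall n, (N <= n)%N -> rnorm (l - u n) < e.
Proof.
move=> hu; have : cvgn u.
  apply: cauchy_cvg; apply: cauchy_exP => e /= e0.
  have eE : e = (complex.Re e)%:C%C by rewrite RRe_real// gtr0_real.
  have [|N hN] := hu (complex.Re e); first by rewrite -ltcR -eE.
  exists (u N); exists N => // n /= Nn; rewrite -ball_normE /= normr_rnorm eE ltcR.
  exact: hN.
move=> /cvg_ex[l ul]; exists l => e e0.
have : nbhs l (ball l e%:C%C) by apply: nbhsx_ballx; rewrite ltcR.
move=> /ul [N _ hN]; exists N => n Nn.
by have := hN n Nn; rewrite -ball_normE /= normr_rnorm ltcR.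
Qed.

Lemma precompact_net (W : set H) : precompact W -> forall e : R, 0 < e ->
  exists s : seq H, forall v, W v -> exists2 y, y \in s & rnorm (v - y) < e.
Proof.
rewrite precompactE => cW e e0.
have := cW; rewrite compact_cover => /(_ H setT (fun y => ball y e%:C%C)).
case=> [y _|v _|D _ WD]; first by apply: ball_open; rewrite ltcR.
- by exists v => //; apply: ballxx; rewrite ltcR.
exists (finmap.enum_fset D) => v /(@subset_closure _ _) /WD [y /= yD].
by rewrite -ball_normE /= normr_rnorm ltcR rnormC; exists y.
Qed.

Lemma linear_cont_nr T : linear T ->
  continuous T <-> exists2 M : R, 0 <= M & forall v, rnorm (T v) <= M * rnorm v.
Proof.
move=> lT; have T0 : T 0 = 0 by have := lT (-1) 0 0; rewrite scaler0 addr0 scaleN1r addNr.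
have TZ a v : T (a *: v) = a *: T v by have := lT a v 0; rewrite T0 !addr0.
have TB u v : T (v - u) = T v - T u.
  by rewrite addrC -scaleN1r lT scaleN1r addrC.
split => [cT|[M M0 hM] v].
  have /cT : nbhs (T 0) (ball (T 0) (1%:C%C : R[i])) by apply: nbhsx_ballx; rewrite ltcR.
  move=> /nbhs_nrP[e e0 he]; exists (2 / e); first by rewrite divr_ge0// ltW.
  move=> v; have [v0|v0] := eqVneq (rnorm v) 0.
    by rewrite (rnorm_eq0 v0) T0 /rnorm normr0 mulr0.
  have vp : 0 < rnorm v by rewrite lt_neqAle eq_sym v0 rnorm_ge0.
  (* Rescaled to length e / 2, the vector lies strictly inside the radius e on which T has norm
     below 1; hence the constant 2 / e. *)
  have := he ((e / 2 / rnorm v)%:C%C *: v); rewrite sub0r rnormN rnormZr ger0_norm; last first.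
    by rewrite !divr_ge0// ltW.
  have e2 : e / 2 < e by lra.
  rewrite divfK// => /(_ e2) /=.
  rewrite T0 -ball_normE /= sub0r normrN normr_rnorm ltcR TZ rnormZr ger0_norm; last first.
    by rewrite !divr_ge0// ltW.
    rewrite -(ltr_pM2r vp) mul1r.
  have -> : e / 2 / rnorm v * rnorm (T v) * rnorm v = e / 2 * rnorm (T v) by field.
  by move=> h; rewrite mulrAC ler_pdivlMr//; lra.
move=> W /nbhs_nrP[e e0 he]; apply/nbhs_nrP; exists (e / (M + 1)).
  by rewrite divr_gt0// ltr_wpDl.
move=> u; rewrite ltr_pdivlMr ?ltr_wpDl// => h; apply: he; rewrite -TB.
apply: (le_lt_trans (hM _)); apply: le_lt_trans h.
by rewrite mulrDr mulr1 mulrC lerDl rnorm_ge0.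
Qed.

Lemma bounded_opP T : bounded_op T <->
  linear T /\ exists2 M : R, 0 <= M & forall v, rnorm (T v) <= M * rnorm v.
Proof. by split => -[lT /(linear_cont_nr lT)]. Qed.

Section OpNorm.
Variable T : H -> H.
Hypothesis bT : bounded_op T.

Lemma bop0 : T 0 = 0.
Proof. by have := bT.1 (-1) 0 0; rewrite scaler0 addr0 scaleN1r addNr. Qed.

Lemma bopD u v : T (u + v) = T u + T v.
Proof. by rewrite -[u]scale1r bT.1 !scale1r. Qed.

Lemma bopZ (a : R[i]) u : T (a *: u) = a *: T u.
Proof. by rewrite -[in LHS](addr0 (_ *: _)) bT.1 bop0 addr0. Qed.

Lemma bopN u : T (- u) = - T u.
Proof. by rewrite -scaleN1r bopZ scaleN1r. Qed.

Lemma bopB u v : T (u - v) = T u - T v.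
Proof. by rewrite bopD bopN. Qed.

Lemma bop_bd : exists2 M : R, 0 <= M & forall v, rnorm (T v) <= M * rnorm v.
Proof. by have [] := (bounded_opP T).1 bT. Qed.

Lemma opnorm_has_sup : has_sup [set complex.Re `|T v| | v in [set v : H | `|v| <= 1]].
Proof.
split; first by exists (complex.Re `|T 0|), 0 => //=; rewrite normr0.
have [M M0 hM] := bop_bd; exists M => _ [v /= v1 <-]; apply: (le_trans (hM v)).
by rewrite ler_piMr// -lecR -normr_rnorm.
Qed.

Lemma le_opnorm v : rnorm (T v) <= opnorm T * rnorm v.
Proof.
have [v0|v0] := eqVneq (rnorm v) 0.
  by rewrite (rnorm_eq0 v0) bop0 rnorm0 mulr0.
have vp : 0 < rnorm v by rewrite lt_neqAle eq_sym v0 rnorm_ge0.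
rewrite -ler_pdivrMr//; apply: (ub_le_sup opnorm_has_sup.2).
exists ((rnorm v)^-1%:C%C *: v); last first.
  by rewrite bopZ -[LHS]/(rnorm _) rnormZr ger0_norm ?invr_ge0 ?(ltW vp)// mulrC.
by rewrite /= normr_rnorm (lecR _ 1) rnormZr ger0_norm ?invr_ge0 ?(ltW vp)// mulVf.
Qed.

Lemma opnorm_le (M : R) : 0 <= M -> (forall v, rnorm (T v) <= M * rnorm v) -> opnorm T <= M.
Proof.
move=> M0 hM; apply: ge_sup; first exact: opnorm_has_sup.1.
move=> _ [v /= v1 <-]; apply: (le_trans (hM v)).
by rewrite ler_piMr// -lecR -normr_rnorm.
Qed.

Lemma opnorm_ge0 : 0 <= opnorm T.
Proof.
apply: (ub_le_sup opnorm_has_sup.2); exists 0; first by rewrite /= normr0.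
by rewrite bop0 normr0.
Qed.

End OpNorm.

Lemma bop_id : bounded_op (id : H -> H).
Proof. by apply/bounded_opP; split => //; exists 1 => // v; rewrite mul1r. Qed.

Lemma bop_add T S : bounded_op T -> bounded_op S -> bounded_op (fun v => T v + S v).
Proof.
move=> /bounded_opP[lT [M M0 hM]] /bounded_opP[lS [N N0 hN]]; apply/bounded_opP; split.
  by move=> a u v; rewrite lT lS scalerDr addrACA.
by exists (M + N); [exact: addr_ge0|move=> v; rewrite mulrDl (le_trans (rnormD _ _))// lerD].
Qed.

Lemma bop_scale (a : R[i]) T : bounded_op T -> bounded_op (fun v => a *: T v).
Proof.
move=> /bounded_opP[lT [M M0 hM]]; apply/bounded_opP; split.
  by move=> b u v; rewrite lT scalerDr !scalerA mulrC.
have a0 : 0 <= complex.Re `|a| by rewrite normc_def /= sqrtr_ge0.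
exists (complex.Re `|a| * M); first exact: mulr_ge0.
by move=> v; rewrite rnormZ -mulrA ler_wpM2l.
Qed.

Lemma bop_sub T S : bounded_op T -> bounded_op S -> bounded_op (fun v => T v - S v).
Proof.
move=> bT /(bop_scale (-1)) /(bop_add bT).
by congr bounded_op; apply/funext => v; rewrite scaleN1r.
Qed.

Lemma bop_comp T S : bounded_op T -> bounded_op S -> bounded_op (T \o S).
Proof.
move=> /bounded_opP[lT [M M0 hM]] /bounded_opP[lS [N N0 hN]]; apply/bounded_opP; split.
  by move=> a u v /=; rewrite lS lT.
exists (M * N); first exact: mulr_ge0.
by move=> v /=; rewrite (le_trans (hM _))// -mulrA ler_wpM2l.
Qed.

(** Trades the supremum for bounds on vectors, the form in which all later norm estimates are
    made. *)
Lemma opnorm_continuousP (X : topologicalType) (F : X -> H -> H) :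
  opnorm_continuous F <-> (forall x, bounded_op (F x)) /\
  forall x (e : R), 0 < e ->
    \forall y \near x, forall v, rnorm (F y v - F x v) <= e * rnorm v.
Proof.
split=> -[bF cF]; split=> // x.
  move=> e e0; have bD y : bounded_op (fun v => F y v - F x v) by exact: bop_sub.
  have /cvgrPdist_lt/(_ e e0) := cF x; apply: filterS => y /=.
  rewrite sub0r normrN ger0_norm ?opnorm_ge0// => h v.
  by rewrite (le_trans (le_opnorm (bD y) v))// ler_wpM2r ?rnorm_ge0// ltW.
apply/cvgrPdist_le => /= e e0; have := cF x e e0; apply: filterS => y h.
have bD : bounded_op (fun v => F y v - F x v) by exact: bop_sub.
by rewrite sub0r normrN ger0_norm ?opnorm_ge0// opnorm_le// ltW.
Qed.

End Topology.

(** * First and second moments of finite measures on the line *)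

Section FiniteMeasureOnLine.
Variables (R : realType) (mu : {measure set (measurableTypeR R) -> \bar R}).
Hypothesis mufin : (mu setT < +oo)%E.

Local Notation sqint m := (\int[m]_t ((t : R) ^+ 2)%:E)%E.

Lemma measurable_id_EFin : measurable_fun [set: measurableTypeR R] (fun t : measurableTypeR R => (t : R)%:E).
Proof. exact/measurable_EFinP. Qed.

Lemma measurable_sqr_EFin :
  measurable_fun [set: measurableTypeR R] (fun t : measurableTypeR R => ((t : R) ^+ 2)%:E).
Proof. by apply/measurable_EFinP; apply: measurable_funX. Qed.

Lemma cst_integrable (D : set (measurableTypeR R)) (a : R) : measurable D ->
  mu.-integrable D (EFin \o cst a).
Proof.
move=> mD; apply/integrableP; split; first exact/measurable_EFinP/measurable_cst.
rewrite (eq_integral (cst `|a|%:E)) => [|t _]; last by [].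
rewrite integral_cst// lte_mul_pinfty ?lee_fin//.
by apply: le_lt_trans mufin; apply: le_measure; rewrite ?inE.
Qed.

(** Domination by t^2 + 1, which is integrable because the measure is finite. *)
Lemma sqint_integrable : (sqint mu < +oo)%E ->
  mu.-integrable setT (fun t : measurableTypeR R => (t : R)%:E).
Proof.
move=> sq; have i2 : mu.-integrable setT (fun t : measurableTypeR R => ((t : R) ^+ 2)%:E).
  apply/integrableP; split; first exact: measurable_sqr_EFin.
  by under eq_integral => t _ do rewrite gee0_abs ?lee_fin ?sqr_ge0//.
have i1 := @cst_integrable setT 1 measurableT.
apply: le_integrable (integrableD measurableT i1 i2) => //.
  exact: measurable_id_EFin.
move=> t _; rewrite /= lee_fin [leRHS]ger0_norm ?addr_ge0 ?sqr_ge0//.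
rewrite -[t ^+ 2]real_normK ?num_real//; set s := `|t|.
by have := sqr_ge0 (s - 1); rewrite sqrrB1 mulr2n; have := normr_ge0 t; rewrite -/s; lra.
Qed.

Variable S : set (measurableTypeR R).
Hypotheses (mS : measurable S) (muS : mu (~` S) = 0%E).

Lemma mu_concentrated : mu S = mu setT.
Proof.
by rewrite -(setUv S) measureU//; [rewrite [X in (_ + X)%E]muS adde0|exact: measurableC|exact: setICr].
Qed.

Lemma Rint_concentrated (f : R -> R) : mu.-integrable setT (EFin \o f) ->
  (\int[mu]_t f t = \int[mu]_(t in S) f t)%R.
Proof.
move=> fi; rewrite /Rintegral (@negligible_integral _ _ _ mu setT (~` S))//; last exact: measurableC.
by rewrite setTD setCK.
Qed.

Lemma sqint_bounded (M : R) : (forall t, S t -> `|t| <= M) -> (sqint mu < +oo)%E.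
Proof.
move=> SM; rewrite (@ge0_negligible_integral _ _ _ mu setT (~` S))//; last 3 first.
- exact: measurableC.
- exact: measurable_sqr_EFin.
- by move=> t _; rewrite lee_fin sqr_ge0.
rewrite setTD setCK; apply: (@le_lt_trans _ _ (\int[mu]_(t in S) (M ^+ 2)%:E)%E).
  apply: ge0_le_integral => //.
  - by move=> t _; rewrite lee_fin sqr_ge0.
  - exact: measurable_funS measurable_sqr_EFin.
  - move=> t St; rewrite lee_fin -[t ^+ 2]real_normK ?num_real//.
    by rewrite ler_sqr ?nnegrE ?SM// (le_trans _ (SM _ St)).
by rewrite integral_cst// mu_concentrated lte_mul_pinfty ?lee_fin ?sqr_ge0.
Qed.

Hypothesis sq : (sqint mu < +oo)%E.

Let idi : mu.-integrable S (fun t : measurableTypeR R => (t : R)%:E).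
Proof. by apply: integrableS (sqint_integrable sq). Qed.

Lemma Rint_ge (a : R) : (forall t, S t -> a <= t) ->
  a * fine (mu setT) <= (\int[mu]_t (t : R))%R.
Proof.
move=> aS; rewrite (Rint_concentrated (sqint_integrable sq)) -mu_concentrated.
by rewrite -Rintegral_cst//; apply: le_Rintegral => //; exact: cst_integrable.
Qed.

Lemma Rint_le (a : R) : (forall t, S t -> t <= a) ->
  (\int[mu]_t (t : R))%R <= a * fine (mu setT).
Proof.
move=> aS; rewrite (Rint_concentrated (sqint_integrable sq)) -mu_concentrated.
by rewrite -Rintegral_cst//; apply: le_Rintegral => //; exact: cst_integrable.
Qed.

(** On S the function t - a has constant sign and integral zero, so it vanishes almost everywhere;
    as it has no zero in S, the set S is null. *)
Lemma Rint_eq_null (a : R) : (forall t, S t -> t != a) ->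
  (forall t, S t -> a <= t) \/ (forall t, S t -> t <= a) ->
  (\int[mu]_t (t : R))%R = a * fine (mu setT) -> mu setT = 0%E.
Proof.
move=> Sa cmp; rewrite (Rint_concentrated (sqint_integrable sq)) -mu_concentrated.
move=> eq0; have bi : mu.-integrable S (EFin \o (fun t : measurableTypeR R => t - a)).
  rewrite (_ : _ \o _ = ((EFin \o (fun t : measurableTypeR R => t : R)) \- (EFin \o cst a))%E)//.
  by apply: integrableB => //; exact: cst_integrable.
have e0 : (\int[mu]_(t in S) (t - a) = 0)%R.
  by rewrite RintegralB//; [rewrite eq0 Rintegral_cst// subrr|exact: cst_integrable].
have z : (\int[mu]_(t in S) `|t - a| = 0)%R.
  case: cmp => cmp.
    by rewrite -[RHS]e0; apply: eq_Rintegral => t /set_mem St; rewrite ger0_norm ?subr_ge0 ?cmp.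
  transitivity (-1 * \int[mu]_(t in S) (t - a))%R; last by rewrite e0 mulr0.
  rewrite -RintegralZl//.
  by apply: eq_Rintegral => t /set_mem St; rewrite ler0_norm ?subr_le0 ?cmp// mulN1r.
have : (\int[mu]_(t in S) `|(t - a)%:E| = 0)%E.
  move: z; rewrite /Rintegral; set I := (\int[mu]_(_ in _) _)%E.
  have fI : I \is a fin_num by apply: integrable_fin_num => //; exact: integrable_norm.
  by move=> z; rewrite -[LHS](fineK fI) z.
move=> /(ae_eq_integral_abs _ _ _).1 => h.
have {h} : ae_eq mu S (fun t : measurableTypeR R => (t - a)%:E) (cst 0%E).
  by apply: h => //; exact: measurable_int bi.
rewrite /ae_eq => h; apply/eqP; rewrite eq_le measure_ge0 andbT.
have : mu.-negligible S.
  apply: negligibleS h => t St /= /(_ St) [] /eqP; rewrite subr_eq0.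
  by apply/negP; exact: Sa.
by move=> /negligibleP ->.
Qed.

End FiniteMeasureOnLine.

Section MeasureAdd.
Variables (R : realType) (m1 m2 : {measure set (measurableTypeR R) -> \bar R}).
Local Notation sqint m := (\int[m]_t ((t : R) ^+ 2)%:E)%E.

Lemma sqint_ge0 (m : {measure set (measurableTypeR R) -> \bar R}) : (0 <= sqint m)%E.
Proof. by apply: integral_ge0 => t _; rewrite lee_fin sqr_ge0. Qed.

Lemma sqint_measure_add : sqint (measure_add m1 m2) = (sqint m1 + sqint m2)%E.
Proof.
rewrite ge0_integral_measure_add//; last exact: measurable_sqr_EFin.
by move=> t _; rewrite lee_fin sqr_ge0.
Qed.

Lemma sqint_measure_add_lty :
  (sqint (measure_add m1 m2) < +oo <-> sqint m1 < +oo /\ sqint m2 < +oo)%E.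
Proof.
rewrite sqint_measure_add; have := sqint_ge0 m1; have := sqint_ge0 m2.
set I := sqint m1; set K := sqint m2 => K0 I0.
split=> [h|[h1 h2]]; last exact: lte_add_pinfty.
by split; apply: le_lt_trans h; [exact: leeDl|exact: leeDr].
Qed.

Lemma Rint_measure_add : (m1 setT < +oo)%E -> (m2 setT < +oo)%E ->
  (sqint m1 < +oo)%E -> (sqint m2 < +oo)%E ->
  (\int[measure_add m1 m2]_t (t : R) = \int[m1]_t (t : R) + \int[m2]_t (t : R))%R.
Proof.
move=> f1 f2 s1 s2; have i1 := sqint_integrable f1 s1; have i2 := sqint_integrable f2 s2.
rewrite /Rintegral integral_measure_add//; rewrite fineD//.
  exact: (integrable_fin_num measurableT i1).
exact: (integrable_fin_num measurableT i2).
Qed.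

Lemma measure_add_lty : (m1 setT < +oo)%E -> (m2 setT < +oo)%E ->
  (measure_add m1 m2 setT < +oo)%E.
Proof. by move=> f1 f2; rewrite measure_addE lte_add_pinfty. Qed.

End MeasureAdd.

Section DiracMass.
Variables (R : realType) (a : R) (q : R).
Hypothesis q0 : 0 <= q.

(** The part of a scalar spectral measure that comes from an eigenvector for a whose squared norm is
    q. *)
Definition dmass : {measure set (measurableTypeR R) -> \bar R} :=
  mscale (NngNum q0) (dirac (a : measurableTypeR R)).

Lemma dmassE (S : set R) : dmass S = (if a \in S then q else 0)%:E.
Proof. by rewrite /dmass /= /mscale /= diracE; case: ifP; rewrite ?mule1 ?mule0. Qed.

Lemma dmass_lty : (dmass setT < +oo)%E. Proof. by rewrite dmassE ltry. Qed.

Let null : dmass (~` [set a]) = 0%E.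
Proof. by rewrite dmassE; case: ifP => //; rewrite in_setC in_set1 eqxx. Qed.

Lemma dmass_sqint : (\int[dmass]_t ((t : R) ^+ 2)%:E < +oo)%E.
Proof.
apply: (sqint_bounded dmass_lty (S := [set a]) (M := `|a|) _ null) => [|t ->//].
exact: measurable_set1.
Qed.

(** The two moment bounds, applied to the one-point set of a, squeeze the integral. *)
Lemma dmass_int : (\int[dmass]_t (t : R))%R = a * q.
Proof.
have e : fine (dmass setT) = q by rewrite dmassE in_setT.
have mS := @measurable_set1 R a.
have h1 : (\int[dmass]_t (t : R))%R <= a * fine (dmass setT).
  by apply: (Rint_le dmass_lty mS null dmass_sqint) => t ->.
have h2 : a * fine (dmass setT) <= (\int[dmass]_t (t : R))%R.
  by apply: (Rint_ge dmass_lty mS null dmass_sqint) => t ->.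
by apply/eqP; rewrite eq_le; rewrite e in h1 h2; rewrite h1 h2.
Qed.

End DiracMass.

(** * Projections and spectral measures *)

Section Projections.
Variables (R : realType) (H : completeNormedModType R[i]) (dot : {dot H for Num.conj}).
Hypothesis hH : is_hilbert dot.
Local Notation rd := (rdot dot).

Lemma eq_dotr u v : (forall w, rd w u = rd w v) -> u = v.
Proof.
move=> h; apply/eqP; rewrite -subr_eq0; apply/eqP/(rdot_eq0 hH).
by rewrite rdotBr h subrr.
Qed.

Lemma graph_saP T : self_adjoint dot (graph T) <-> forall u v, dot (T u) v = dot u (T v).
Proof.
split=> [sT u v|sT].
  have : adjoint dot (graph T) (v, T v) by rewrite sT.
  exact.
apply/seteqP; split=> -[u w] /=.
  move=> h; apply: eq_dotr => v; have := h v (T v) erefl => /= e.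
  by rewrite /rdot /= -e sT.
by rewrite /graph /= => -> v w' /= ->; exact: sT.
Qed.

Lemma rsym_sa T : bounded_op T -> (forall u v, rd (T u) v = rd u (T v)) ->
  self_adjoint dot (graph T).
Proof.
move=> bT h; apply/graph_saP => u v; apply: eq_dot_rdot => a.
by rewrite -bopZ.
Qed.

Lemma sa_rsym T : self_adjoint dot (graph T) -> forall u v, rd (T u) v = rd u (T v).
Proof. by move=> /graph_saP h u v; rewrite /rd h. Qed.

Section Proj.
Variable P : H -> H.
Hypothesis pP : projection dot P.

Lemma proj_bop : bounded_op P. Proof. by case: pP. Qed.

Lemma proj_sym u v : rd (P u) v = rd u (P v).
Proof. by apply: sa_rsym; case: pP. Qed.

Lemma proj_idem v : P (P v) = P v. Proof. by case: pP. Qed.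

Lemma proj_rd v : rd (P v) v = rd (P v) (P v).
Proof. by rewrite [RHS]proj_sym proj_idem rdotC. Qed.

Lemma proj_pyth v : rd v v = rd (P v) (P v) + rd (v - P v) (v - P v).
Proof. rewrite !rdotBl !rdotBr -proj_rd (rdotC dot v (P v)); ring. Qed.

Lemma proj_le v : rd (P v) (P v) <= rd v v.
Proof. by rewrite [leRHS]proj_pyth lerDl rdot_ge0. Qed.

Lemma proj_fix v : rd v v <= rd (P v) (P v) -> P v = v.
Proof.
rewrite [leLHS]proj_pyth => h; apply/esym/eqP; rewrite -subr_eq0; apply/eqP/(rdot_eq0 hH).
by apply/eqP; rewrite eq_le rdot_ge0// andbT; lra.
Qed.

End Proj.

Lemma projP P : bounded_op P -> (forall u v, rd (P u) v = rd u (P v)) ->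
  (forall v, P (P v) = P v) -> projection dot P.
Proof. by move=> bP sP iP; split => //; exact: rsym_sa. Qed.

End Projections.

Section SpectralMeasure.
Variables (R : realType) (H : completeNormedModType R[i]) (dot : {dot H for Num.conj}).
Hypothesis hH : is_hilbert dot.
Variables (A : set (H * H)) (E : set R -> H -> H).
Hypotheses (hop : is_operator A) (hsa : self_adjoint dot A) (hd : dense (dom A)).
Hypothesis hE : is_spectral_measure dot A E.
Implicit Types (u v w : H) (S T : set R).
Local Notation rd := (rdot dot).


Lemma opA_lin (a : R[i]) v w v' w' : A (v, w) -> A (v', w') -> A (a *: v + v', a *: w + w').
Proof. by case: hop => _ + _; exact. Qed.

Lemma opA0 : A (0, 0). Proof. by case: hop. Qed.

Lemma opA_uniq v w w' : A (v, w) -> A (v, w') -> w = w'.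
Proof. by case: hop => _ _; exact. Qed.

Lemma opAD v w v' w' : A (v, w) -> A (v', w') -> A (v + v', w + w').
Proof. by move=> h /(opA_lin 1 h); rewrite !scale1r. Qed.

Lemma opAZ (a : R[i]) v w : A (v, w) -> A (a *: v, a *: w).
Proof. by move=> h; have := opA_lin a h opA0; rewrite !addr0. Qed.

Lemma opAN v w : A (v, w) -> A (- v, - w).
Proof. by move/(opAZ (-1)); rewrite !scaleN1r. Qed.

Lemma opAB v w v' w' : A (v, w) -> A (v', w') -> A (v - v', w - w').
Proof. by move=> h /opAN; exact: opAD. Qed.

Lemma opA_sym v w v' w' : A (v, w) -> A (v', w') -> rd w v' = rd v w'.
Proof. by move=> h; rewrite -{1}hsa => /(_ _ _ h) /=; rewrite /rdot => ->. Qed.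

Lemma spectral_proj S : measurable S -> projection dot (E S).
Proof. by case: hE => h _ _; exact: h. Qed.

Lemma spectral_T v : E setT v = v. Proof. by case: hE. Qed.

Lemma spectral_meas v : exists mu : {measure set (measurableTypeR R) -> \bar R},
  [/\ forall S, measurable S -> mu S = (rd (E S v) v)%:E,
      dom A v <-> (\int[mu]_t ((t : R) ^+ 2)%:E < +oo)%E &
      forall w, A (v, w) -> rd w v = (\int[mu]_t (t : R))%R].
Proof.
case: hE => _ _ /(_ v)[mu [h1 h2 h3]]; exists mu; split => // w /h3.
by rewrite /rdot => ->.
Qed.

Lemma spectral_add S T v : measurable S -> measurable T -> S `&` T = set0 ->
  rd (E (S `|` T) v) v = rd (E S v) v + rd (E T v) v.
Proof.
move=> mS mT ST; have [mu [h _ _]] := spectral_meas v; apply: EFin_inj.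
by rewrite EFinD -!h//; [exact: measureU|exact: measurableU].
Qed.

(* For u in the range of E T, E (S `|` T) u has squared norm
   |E S u|^2 + |u|^2, which is at most |u|^2. *)
Lemma spectral_disj S T v : measurable S -> measurable T -> S `&` T = set0 -> E S (E T v) = 0.
Proof.
move=> mS mT ST; set u := E T v; have uE : E T u = u by rewrite /u (proj_idem (spectral_proj mT)).
have := spectral_add u mS mT ST; rewrite !proj_rd//; [|exact: spectral_proj|exact: spectral_proj|by apply/spectral_proj/measurableU].
rewrite uE => h; have := proj_le hH (spectral_proj (measurableU _ _ mS mT)) u; rewrite h => le.
by apply: (rdot_eq0 hH); apply/eqP; rewrite eq_le rdot_ge0// andbT; move: le; lra.
Qed.

(** Additivity is known only for quadratic forms. The defect [w] is killed by both projections, and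
    its squared norm is the sum of their forms at [w], hence zero. *)
Lemma spectral_C S v : measurable S -> E S v + E (~` S) v = v.
Proof.
move=> mS; have mC : measurable (~` S) by exact: measurableC.
apply/esym/eqP; rewrite -subr_eq0; apply/eqP; set w := v - _.
apply: (rdot_eq0 hH); rewrite -{1}[w]spectral_T -(setUv S) spectral_add ?setICr//.
have z1 : E S w = 0.
  rewrite /w (bopB (proj_bop (spectral_proj mS))) (bopD (proj_bop (spectral_proj mS))) (proj_idem (spectral_proj mS)).
  by rewrite spectral_disj ?setICr// addr0 subrr.
have z2 : E (~` S) w = 0.
  rewrite /w (bopB (proj_bop (spectral_proj mC))) (bopD (proj_bop (spectral_proj mC))) (proj_idem (spectral_proj mC)).
  by rewrite spectral_disj ?setICl// add0r subrr.
by rewrite z1 z2 rdot0l addr0.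
Qed.

Lemma spectral_subl S T v : measurable S -> measurable T -> S `<=` T -> E T (E S v) = E S v.
Proof.
move=> mS mT ST; rewrite -[RHS](spectral_C (E S v) mT) (@spectral_disj (~` T)) ?addr0//.
  exact: measurableC.
by rewrite setIC; apply/disjoints_subset; rewrite setCK.
Qed.

Lemma spectral_subr S T v : measurable S -> measurable T -> S `<=` T -> E S (E T v) = E S v.
Proof.
move=> mS mT ST; have mC : measurable (~` T) by exact: measurableC.
rewrite -{2}(spectral_C v mT) (bopD (proj_bop (spectral_proj mS))) (@spectral_disj S (~` T)) ?addr0//.
by apply/disjoints_subset; rewrite setCK.
Qed.

(** The set [Z] completes S and T to a partition. As for [spectral_C], v is the sum of its three
    components, and the projection of the union fixes two of them and kills the third. *)
Lemma spectral_U S T v : measurable S -> measurable T -> S `&` T = set0 ->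
  E (S `|` T) v = E S v + E T v.
Proof.
move=> mS mT ST; have mU := measurableU _ _ mS mT; set Z := ~` (S `|` T).
have mZ : measurable Z by exact: measurableC.
have SZ : S `&` Z = set0 by apply/disjoints_subset; rewrite setCK; exact: subsetUl.
have TZ : T `&` Z = set0 by apply/disjoints_subset; rewrite setCK; exact: subsetUr.
have TS : T `&` S = set0 by rewrite setIC.
have ZS : Z `&` S = set0 by rewrite setIC.
have ZT : Z `&` T = set0 by rewrite setIC.
have dec : v = E S v + E T v + E Z v.
  apply/eqP; rewrite -subr_eq0; apply/eqP; set w := v - _.
  apply: (rdot_eq0 hH); rewrite -{1}[w]spectral_T -(setUv (S `|` T)) spectral_add ?setICr// spectral_add//.
  have z1 : E S w = 0.
    rewrite /w (bopB (proj_bop (spectral_proj mS))) !(bopD (proj_bop (spectral_proj mS))) (proj_idem (spectral_proj mS)).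
    by rewrite !spectral_disj// !addr0 subrr.
  have z2 : E T w = 0.
    rewrite /w (bopB (proj_bop (spectral_proj mT))) !(bopD (proj_bop (spectral_proj mT))) (proj_idem (spectral_proj mT)).
    by rewrite !spectral_disj// addr0 add0r subrr.
  have z3 : E Z w = 0.
    rewrite /w (bopB (proj_bop (spectral_proj mZ))) !(bopD (proj_bop (spectral_proj mZ))) (proj_idem (spectral_proj mZ)).
    by rewrite !spectral_disj// !add0r subrr.
  by rewrite z1 z2 z3 !rdot0l !addr0.
rewrite {1}dec !(bopD (proj_bop (spectral_proj mU))) (@spectral_subl S)// ?(@spectral_subl T)//.
by rewrite (@spectral_disj (S `|` T) Z) ?addr0// setICr.
Qed.

Lemma spectral_I S T v : measurable S -> measurable T -> E S (E T v) = E (S `&` T) v.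
Proof.
move=> mS mT; have mI := measurableI _ _ mS mT; have mD := measurableD mS mT.
rewrite -{1}(setUIDK S T) spectral_U//; last first.
  by apply/seteqP; split => // t [[_ ?] [_ ?]].
rewrite spectral_subr// spectral_disj// ?addr0//; apply/seteqP; split => // t [[_ ?] ?] //.
Qed.

Lemma spectral_comm S T v : measurable S -> measurable T -> E S (E T v) = E T (E S v).
Proof. by move=> mS mT; rewrite !spectral_I// setIC. Qed.

Lemma spectral_meas_lty v (mu : {measure set (measurableTypeR R) -> \bar R}) :
  (forall S, measurable S -> mu S = (rd (E S v) v)%:E) -> (mu setT < +oo)%E.
Proof. by move=> ->//; rewrite ltry. Qed.

(* The measure of v + w is the sum of those of v and w, so the form of A has no
   cross term. *)
Lemma spectral_split S v w : measurable S -> E S v = v -> E S w = 0 -> 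
  (dom A (v + w) <-> dom A v /\ dom A w) /\
  forall a b, A (v, a) -> A (w, b) -> rd a w = 0.
Proof.
move=> mS Sv Sw.
have [mu [mu1 mu2 mu3]] := spectral_meas (v + w).
have [mv [mv1 mv2 mv3]] := spectral_meas v.
have [mw [mw1 mw2 mw3]] := spectral_meas w.
have cross T : measurable T -> rd (E T v) w = 0.
  move=> mT; rewrite -{1}Sv spectral_comm// (proj_sym hH (spectral_proj mS)) Sw rdot0r//.
have addm T : measurable T -> mu T = measure_add mv mw T.
  move=> mT; rewrite measure_addE mu1// mv1// mw1// -EFinD; congr EFin.
  by rewrite (bopD (proj_bop (spectral_proj mT))) !rdotDl !rdotDr (proj_sym hH (spectral_proj mT) w v) (rdotC dot w (E T v)) !cross//
  addr0 add0r.
have dE : dom A (v + w) <-> dom A v /\ dom A w.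
  rewrite mu2 mv2 mw2 (eq_measure_integral (measure_add mv mw)) => [|B mB _]; last exact: addm.
  exact: sqint_measure_add_lty.
split => // a b Aa Ab.
have sv : (\int[mv]_t ((t : R) ^+ 2)%:E < +oo)%E by apply/mv2; exists a.
have sw : (\int[mw]_t ((t : R) ^+ 2)%:E < +oo)%E by apply/mw2; exists b.
have : rd (a + b) (v + w) = rd a v + rd b w.
  rewrite (mu3 _ (opAD Aa Ab)) (mv3 _ Aa) (mw3 _ Ab).
  rewrite -(Rint_measure_add (spectral_meas_lty mv1) (spectral_meas_lty mw1) sv sw) /Rintegral.
  by congr fine; apply: eq_measure_integral => B mB _; exact: addm.
rewrite !rdotDl !rdotDr (opA_sym Ab Aa) (rdotC dot w a); lra.
Qed.

Lemma spectral_dom S v : measurable S -> dom A v -> dom A (E S v).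
Proof.
move=> mS dv; have := spectral_split (v := E S v) (w := E (~` S) v) mS.
rewrite (proj_idem (spectral_proj mS)) spectral_disj ?setICr//; last exact: measurableC.
by rewrite spectral_C// => /(_ erefl erefl)[[/(_ dv)[]]].
Qed.

(** The part [z] of w outside S is orthogonal to the domain, because the form of A has no cross
    terms between S and its complement. The domain is dense, so [z] is zero. *)
Lemma spectral_stable S v w : measurable S -> E S v = v -> A (v, w) -> E S w = w.
Proof.
move=> mS Sv Aw; rewrite -[RHS](spectral_C w mS); set z := E (~` S) w.
suff -> : z = 0 by rewrite addr0.
have mC : measurable (~` S) by exact: measurableC.
have z0 u : dom A u -> rd u z = 0.
  move=> du; rewrite /z -(proj_sym hH (spectral_proj mC)) rdotC.
  have [b Ab] := spectral_dom mC du.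
  by apply: (spectral_split (S := S) mS Sv _).2 Aw Ab; rewrite spectral_disj// setICr.
apply: (rdot_eq0 hH); apply/eqP; rewrite eq_le rdot_ge0// andbT.
apply/ler_addgt0Pr => e e0; rewrite add0r.
have z1 : 0 < rnorm z + 1 by rewrite ltr_wpDl ?rnorm_ge0.
have [u du uz] := dense_nr hd z (divr_gt0 e0 z1).
have : rd z z = rd (z - u) z by rewrite rdotBl (z0 u)// subr0.
move=> ->; apply: (le_trans (rdot_CS hH _ _)).
apply: (@le_trans _ _ (e / (rnorm z + 1) * (rnorm z + 1))); last by rewrite divfK// gt_eqF.
apply: ler_pM; rewrite ?rnorm_ge0//; first exact: ltW.
by rewrite lerDl.
Qed.

Lemma spectral_reduce S v w : measurable S -> A (v, w) -> A (E S v, E S w).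
Proof.
move=> mS Aw; have mC : measurable (~` S) by exact: measurableC.
have dv : dom A v by exists w.
have [a Aa] := spectral_dom mS dv; have [b Ab] := spectral_dom mC dv.
have Sa := spectral_stable mS (proj_idem (spectral_proj mS) v) Aa.
have Sb := spectral_stable mC (proj_idem (spectral_proj mC) v) Ab.
have : w = a + b by apply: opA_uniq Aw _; rewrite -(spectral_C v mS); exact: opAD.
move=> ->; rewrite (bopD (proj_bop (spectral_proj mS))) Sa -Sb spectral_disj ?setICr//.
by rewrite addr0.
Qed.

Lemma spectral_bounded_dom S (M : R) v : measurable S -> (forall t, S t -> `|t| <= M) -> dom A (E S v).
Proof.
move=> mS SM; have [mu [mu1 mu2 mu3]] := spectral_meas (E S v); apply/mu2.
apply: (@sqint_bounded _ _ (spectral_meas_lty mu1) S mS _ M SM).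
rewrite mu1; last exact: measurableC.
by rewrite spectral_disj ?rdot0l ?setICl//; exact: measurableC.
Qed.

Section Concentrated.
Variables (S : set R) (v w : H).
Hypotheses (mS : measurable S) (Sv : E S v = v) (Aw : A (v, w)).

Let mu0 mu : (forall S, measurable S -> mu S = (rd (E S v) v)%:E) -> mu (~` S) = 0%E.
Proof.
move=> ->; last exact: measurableC.
by rewrite -{1}Sv spectral_disj ?rdot0l ?setICl//; exact: measurableC.
Qed.

Lemma spectral_form_ge a : (forall t, S t -> a <= t) -> a * rd v v <= rd w v.
Proof.
move=> Sa; have [mu [mu1 mu2 mu3]] := spectral_meas v.
rewrite (mu3 _ Aw); have -> : rd v v = fine (mu setT) by rewrite mu1//= spectral_T.
apply: (@Rint_ge _ _ (spectral_meas_lty mu1) S mS (mu0 mu1) _ a Sa).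
by apply/mu2; exists w.
Qed.

Lemma spectral_form_le a : (forall t, S t -> t <= a) -> rd w v <= a * rd v v.
Proof.
move=> Sa; have [mu [mu1 mu2 mu3]] := spectral_meas v.
rewrite (mu3 _ Aw); have -> : rd v v = fine (mu setT) by rewrite mu1//= spectral_T.
apply: (@Rint_le _ _ (spectral_meas_lty mu1) S mS (mu0 mu1) _ a Sa).
by apply/mu2; exists w.
Qed.

(** Applied to an eigenvector for a whose scalar measure lives strictly on one side of a: there is
    none but zero. *)
Lemma spectral_form_null a : (forall t, S t -> t != a) ->
  (forall t, S t -> a <= t) \/ (forall t, S t -> t <= a) ->
  rd w v = a * rd v v -> v = 0.
Proof.
move=> Sa cmp; have [mu [mu1 mu2 mu3]] := spectral_meas v.
rewrite (mu3 _ Aw); have e : rd v v = fine (mu setT) by rewrite mu1//= spectral_T.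
rewrite e => h; apply: (rdot_eq0 hH); rewrite e.
rewrite (@Rint_eq_null _ _ (spectral_meas_lty mu1) S mS (mu0 mu1) _ a Sa cmp h)//.
by apply/mu2; exists w.
Qed.

End Concentrated.

End SpectralMeasure.

(** * Finite rank and eigenvectors *)

Section RealSpan.
Variables (R : realType) (H : completeNormedModType R[i]) (dot : {dot H for Num.conj}).
Hypothesis hH : is_hilbert dot.
Local Notation rd := (rdot dot).

(** Real coefficients suffice, since the orthogonal projections below are taken with respect to
    [rdot]. *)
Fixpoint rspan (s : seq H) (p : H) : Prop :=
  if s is y :: s' then exists a : R, rspan s' (p - a%:C%C *: y) else p = 0.

Lemma rspan_lin s (a : R) p q : rspan s p -> rspan s q -> rspan s (a%:C%C *: p + q).
Proof.
elim: s p q => [|y s IH] p q /=; first by move=> -> ->; rewrite scaler0 addr0.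
move=> [b hb] [c hc]; exists (a * b + c); have := IH _ _ hb hc; congr rspan.
rewrite scalerBr scalerA rmorphD rmorphM /= scalerDl opprD.
by rewrite addrACA.
Qed.

Lemma rspan_ind s (Q : H -> Prop) : Q 0 -> (forall (a : R) p q, Q p -> Q q -> Q (a%:C%C *: p + q)) ->
  (forall y, y \in s -> Q y) -> forall p, rspan s p -> Q p.
Proof.
move=> Q0 QL; elim: s => [|y s IH] Qs p /=; first by move=> ->.
move=> [a /IH h]; rewrite -(subrK (a%:C%C *: y) p) addrC; apply: QL.
  by apply: Qs; rewrite mem_head.
by apply: h => z zs; apply: Qs; rewrite inE zs orbT.
Qed.

Lemma rspan_orth s w : (forall y, y \in s -> rd w y = 0) -> forall p, rspan s p -> rd w p = 0.
Proof.
move=> hs; apply: rspan_ind => //; first exact: rdot0r.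
by move=> a p q hp hq; rewrite rdotDr rdotZr hp hq mulr0 addr0.
Qed.

(** Gram-Schmidt: [y'] is the part of y orthogonal to the span of s. If it vanishes, y adds nothing;
    otherwise the component of [v'] along [y'] is subtracted as well. *)
Lemma rspan_proj s v : exists2 p, rspan s p & forall y, y \in s -> rd (v - p) y = 0.
Proof.
elim: s v => [|y s IH] v; first by exists 0.
have [p1 sp1 op1] := IH v; have [q sq oq] := IH y.
set y' := y - q; set v' := v - p1.
have yE : y = y' + q by rewrite /y' subrK.
have [y0|y0] := eqVneq (rd y' y') 0.
  exists p1; first by exists 0; rewrite scale0r subr0.
  move=> z; rewrite inE => /predU1P[->|]; last exact: op1.
  by rewrite yE (rdot_eq0 hH y0) add0r; exact: rspan_orth op1 _ sq.
pose a := rd v' y' / rd y' y'.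
exists (p1 + a%:C%C *: y').
  exists a; have -> : p1 + a%:C%C *: y' - a%:C%C *: y = (- a)%:C%C *: q + p1.
    by rewrite /y' scalerBr rmorphN scaleNr addrC addrCA addKr addrC.
  exact: rspan_lin.
have vE : v - (p1 + a%:C%C *: y') = v' - a%:C%C *: y' by rewrite opprD addrA.
have os z : z \in s -> rd (v - (p1 + a%:C%C *: y')) z = 0.
  by move=> zs; rewrite vE rdotBl rdotZl op1// oq// mulr0 subr0.
move=> z; rewrite inE => /predU1P[->|]; last exact: os.
rewrite yE rdotDr (rspan_orth os sq) addr0 vE rdotBl rdotZl /a divfK// subrr//.
Qed.

Lemma rspan_sum s p : rspan s p ->
  exists c : 'I_(size s) -> R[i], p = \sum_(i < size s) c i *: s`_i.
Proof.
elim: s p => [|y s IH] p /=; first by move=> ->; exists (fun=> 0); rewrite big_ord0.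
move=> [a /IH[c hc]].
exists (fun i => if unlift ord0 i is Some j then c j else a%:C%C).
rewrite big_ord_recl unlift_none /= -[LHS](subrK (a%:C%C *: y)) addrC hc; congr (_ + _).
by apply: eq_bigr => i _; rewrite liftK.
Qed.

End RealSpan.

Section FiniteRank.
Variables (R : realType) (H : completeNormedModType R[i]) (dot : {dot H for Num.conj}).
Hypothesis hH : is_hilbert dot.
Variables (A : set (H * H)) (E : set R -> H -> H).
Hypotheses (hop : is_operator A) (hsa : self_adjoint dot A) (hd : dense (dom A)).
Hypothesis hE : is_spectral_measure dot A E.
Implicit Types (u v w : H) (S T : set R).
Local Notation rd := (rdot dot).

Lemma spectral_norm S (M : R) v w : measurable S -> 0 <= M -> (forall t, S t -> `|t| <= M) ->
  E S v = v -> A (v, w) -> rnorm w <= M * rnorm v.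
Proof.
(* w stays in ran (E S), which lies in the domain, so A can be applied a second time; this gives
   [z]. *)
move=> mS M0 SM Sv Aw; have Sw := spectral_stable hH hop hsa hd hE mS Sv Aw.
have [z Az] : dom A w by rewrite -Sw; exact: (spectral_bounded_dom hH hE _ mS SM).
have [w0|w0] := eqVneq (rnorm w) 0; first by rewrite w0 mulr_ge0 ?rnorm_ge0.
have [v0|v0] := eqVneq (rnorm v) 0.
  have := opA0 hop; move: Aw; rewrite (rnorm_eq0 v0) => h /(opA_uniq hop h) ->.
  by rewrite rnorm0 mulr0.
have wp : 0 < rnorm w by rewrite lt_neqAle eq_sym w0 rnorm_ge0.
have vp : 0 < rnorm v by rewrite lt_neqAle eq_sym v0 rnorm_ge0.
have rle u u' : E S u = u -> A (u, u') -> rd u' u <= M * rd u u.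
  move=> Su Au; apply: (spectral_form_le hH hE mS Su Au) => t /SM.
  by apply: le_trans; exact: ler_norm.
have rge u u' : E S u = u -> A (u, u') -> (- M) * rd u u <= rd u' u.
  move=> Su Au; apply: (spectral_form_ge hH hE mS Su Au) => t /SM.
  by rewrite lerNl; apply: le_trans; rewrite -normrN ler_norm.
(* Polarization: apply the bounds on the form to a + b and a - b. *)
pose a := (rnorm w)%:C%C *: v; pose b := (rnorm v)%:C%C *: w.
have bS := proj_bop (spectral_proj hE mS).
have Sa : E S a = a by rewrite /a (bopZ bS) Sv.
have Sb : E S b = b by rewrite /b (bopZ bS) Sw.
have Aa := opAZ hop (rnorm w)%:C%C Aw; have Ab := opAZ hop (rnorm v)%:C%C Az.
have h1 := rle (a + b) _ _ (opAD hop Aa Ab); have h2 := rge (a - b) _ _ (opAB hop Aa Ab).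
rewrite (bopD bS) Sa Sb in h1; rewrite (bopB bS) Sa Sb in h2.
have {}h1 := h1 erefl; have {}h2 := h2 erefl.
have zv : rd z v = rd w w by rewrite (opA_sym hsa Az Aw).
have : 4 * (rnorm v * rnorm w * rd w w) <= M * (rd (a + b) (a + b) + rd (a - b) (a - b)).
  apply: (@le_trans _ _ (rd ((rnorm w)%:C%C *: w + (rnorm v)%:C%C *: z) (a + b) -
      rd ((rnorm w)%:C%C *: w - (rnorm v)%:C%C *: z) (a - b))); last by lra.
  rewrite !(rdotBl, rdotBr, rdotDl, rdotDr) /a /b !rdotZl !rdotZr zv (rdotC dot w v) (rdotC dot z w).
  by rewrite le_eqVlt; apply/orP; left; apply/eqP; ring.
rewrite !(rdotBl, rdotBr, rdotDl, rdotDr) /a /b !rdotZl !rdotZr -!rnorm2// (rdotC dot w v) => h.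
have : rnorm w * (rnorm v * rnorm w ^+ 2) <= (M * rnorm v) * (rnorm v * rnorm w ^+ 2) by lra.
by rewrite ler_pM2r// mulr_gt0// exprn_gt0.
Qed.

Hypothesis hK : compact_resolvent A.

(* The unit ball of ran (E S) lies in the image of a ball under the resolvent,
   hence has a finite net; a unit vector orthogonal to the projected net has
   distance at least 1 from every point of the net. *)
Lemma spectral_finite S (M : R) : measurable S -> 0 <= M -> (forall t, S t -> `|t| <= M) ->
  exists2 s : seq H, (forall y, y \in s -> E S y = y) & forall v, E S v = v -> rspan s v.
Proof.
move=> mS M0 SM; have [K [lK pK] KE] := hK.
have M1 : 0 < M + 1 by rewrite ltr_wpDl.
have KZ (a : R[i]) x : K (a *: x) = a *: K x.
  have K0 : K 0 = 0 by have := lK (-1) 0 0; rewrite scaler0 addr0 scaleN1r addNr.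
  by have := lK a x 0; rewrite K0 !addr0.
(* On ran (E S) the operator A + i has norm at most M + 1, so a unit vector divided by M + 1 lies in
   the image of the unit ball under K. Scaled back by M + 1, the net has mesh 1. *)
have [l hl] := precompact_net pK (divr_gt0 (@ltr01 R) M1).
have bS := proj_bop (spectral_proj hE mS).
exists [seq E S ((M + 1)%:C%C *: y) | y <- l].
  by move=> _ /mapP[y _ ->]; rewrite (proj_idem (spectral_proj hE mS)).
move=> v Sv; have [p sp op] := rspan_proj hH [seq E S ((M + 1)%:C%C *: y) | y <- l] v.
suff : v - p = 0 by move/eqP; rewrite subr_eq0 => /eqP ->.
set u := v - p; have Su : E S u = u.
  rewrite /u (bopB bS) Sv; congr (_ - _); apply: (rspan_ind (Q := fun p => E S p = p)) sp.
  - by rewrite (bop0 bS).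
  - by move=> a x y hx hy; rewrite (bopD bS) (bopZ bS) hx hy.
  - by move=> _ /mapP[y _ ->]; rewrite (proj_idem (spectral_proj hE mS)).
apply: contrapT => u0.
have up : 0 < rnorm u by rewrite lt_neqAle rnorm_ge0 andbT; apply/eqP => /esym/rnorm_eq0.
have [w Aw] : dom A u by rewrite -Su; exact: (spectral_bounded_dom hH hE _ mS SM).
have wM := spectral_norm mS M0 SM Su Aw.
have uK : u = K (w + 'i%C *: u).
  have : op_inv (op_add A (graph (fun v => 'i%C *: v))) (w + 'i%C *: u, u).
    by exists w, ('i%C *: u).
  by rewrite KE.
pose c := (rnorm u * (M + 1))^-1.
have c0 : 0 <= c by rewrite invr_ge0 mulr_ge0// ltW.
have [y yl hy] : exists2 y, y \in l & rnorm (c%:C%C *: u - y) < 1 / (M + 1).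
  apply: hl; exists (c%:C%C *: (w + 'i%C *: u)); last by rewrite KZ -uK.
  rewrite /= normr_rnorm (lecR _ 1) rnormZr ger0_norm// /c mulrC ler_pdivrMr ?mulr_gt0// mul1r.
  rewrite (le_trans (rnormD _ _))// mulrDr mulr1 lerD//; first by rewrite mulrC.
  by rewrite rnormZ normc_def /= expr0n /= add0r expr1n sqrtr1 mul1r.
have ou : rd u ((M + 1)%:C%C *: y) = 0.
  by rewrite -{1}Su (proj_sym hH (spectral_proj hE mS)); apply: op; apply: map_f.
rewrite rdotZr in ou; move/eqP: ou; rewrite mulf_eq0 (gt_eqF M1) /= => /eqP ou.
have : rnorm (c%:C%C *: u) <= rnorm (c%:C%C *: u - y).
  by rewrite (rnorm_sqr_le hH) !(rdotBl, rdotBr) !rdotZl (rdotC dot y) !rdotZl !rdotZr ou; have := rdot_ge0 hH y; lra.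
move=> /le_lt_trans/(_ hy); rewrite rnormZr ger0_norm// /c div1r invfM mulrAC mulVf ?gt_eqF//.
by rewrite mul1r ltxx.
Qed.

End FiniteRank.

Section Eigenvectors.
Variables (R : realType) (H : completeNormedModType R[i]) (dot : {dot H for Num.conj}).
Hypothesis hH : is_hilbert dot.
Variables (A : set (H * H)).
Hypotheses (hop : is_operator A) (hsa : self_adjoint dot A).
Implicit Types (u v w : H).
Local Notation rd := (rdot dot).

Definition eigvec (t : R) v : Prop := A (v, t%:C%C *: v).

(** One component for each distinct eigenvalue, so that the summands are orthogonal and squared
    norms add up. *)
Definition eigen_sum v : Prop := exists (s : seq R) (u : R -> H),
  [/\ uniq s, forall t, eigvec t (u t) & v = \sum_(t <- s) u t].

Lemma eigvec0 t : eigvec t 0.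
Proof. by rewrite /eigvec scaler0; exact: opA0. Qed.

Lemma eigvecZ t (a : R[i]) v : eigvec t v -> eigvec t (a *: v).
Proof. by move=> /(opAZ hop a); rewrite scalerA mulrC -scalerA. Qed.

Lemma eigvec_orth t t' v w : eigvec t v -> eigvec t' w -> t != t' -> rd v w = 0.
Proof.
move=> hv hw tt'; have := opA_sym hsa hv hw; rewrite rdotZl rdotZr => /eqP.
by rewrite -subr_eq0 -mulrBl mulf_eq0 subr_eq0 (negbTE tt') => /eqP.
Qed.

Lemma opA_sum (I : Type) (s : seq I) (Q : pred I) (u w : I -> H) :
  (forall i, A (u i, w i)) -> A (\sum_(i <- s | Q i) u i, \sum_(i <- s | Q i) w i).
Proof.
move=> h; apply: (big_rec2 (fun x y => A (x, y))); first exact: opA0.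
by move=> i x y _; apply: opAD.
Qed.

Lemma eigen_sum_rd s (u : R -> H) : uniq s -> (forall t, eigvec t (u t)) -> forall (g : R -> R),
  rd (\sum_(t <- s) (g t)%:C%C *: u t) (\sum_(t <- s) (g t)%:C%C *: u t) =
  \sum_(t <- s) g t ^+ 2 * rd (u t) (u t).
Proof.
move=> us eu g; elim: s us => [|t s IH]; first by rewrite !big_nil rdot0l.
move=> /= /andP[ts us]; rewrite !big_cons rnormD2 IH// rdotZl rdotZr mulrA -expr2.
have -> : rd ((g t)%:C%C *: u t) (\sum_(j <- s) (g j)%:C%C *: u j) = 0.
  rewrite big_seq; apply: (big_ind (fun x => rd _ x = 0)); first exact: rdot0r.
    by move=> x y hx hy; rewrite rdotDr hx hy addr0.
  move=> t' t's; rewrite rdotZl rdotZr (eigvec_orth (eu t) (eu t')) ?mulr0//.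
  by apply: contraNneq ts => ->.
by rewrite mulr0 addr0.
Qed.

(* Dividing the component of w at each t != z by t - z reduces to the case where
   w is an eigenvector for z; then w = 0, since w is in the range of A - z. *)
Lemma eigen_sum_step (z : R[i]) v w : eigen_sum w -> A (v, z *: v + w) -> eigen_sum v.
Proof.
move=> [s [u [us eu ->]]] Av.
pose v1 := \sum_(t <- s | t%:C%C != z) (t%:C%C - z)^-1 *: u t.
pose w0 := \sum_(t <- s | t%:C%C == z) u t.
have A1 : A (v - v1, z *: (v - v1) + w0).
  have := opAB hop Av (opA_sum s (fun t => t%:C%C != z)
    (fun t => eigvecZ (t%:C%C - z)^-1 (eu t))).
  congr (A (_, _)); rewrite (bigID (fun t => t%:C%C == z)) /= -/w0.
  have key : \sum_(t <- s | t%:C%C != z) u t -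
      \sum_(t <- s | t%:C%C != z) t%:C%C *: ((t%:C%C - z)^-1 *: u t) = - (z *: v1).
    rewrite /v1 scaler_sumr -!sumrN -big_split /=; apply: eq_bigr => t tz.
    rewrite !scalerA -[X in X - _]scale1r -scalerBl -[RHS]scaleNr; congr (_ *: _).
    by move: (t%:C%C) tz => x xz; field; rewrite subr_eq0.
  by rewrite scalerBr -!addrA key; congr (_ + _); exact: addrC.
(* z will be a root of a complex polynomial and need not be real. If it is not, there is no
   component [w0], and symmetry of A forces v - [v1] to vanish. *)
have [z0|z0] := eqVneq (complex.Im z) 0; last first.
  have w00 : w0 = 0.
    rewrite /w0 big1_seq// => t /andP[/eqP tz _]; move: z0.
    by rewrite -tz /= eqxx.
  have v10 : v = v1.
    apply/eqP; rewrite -subr_eq0; apply/eqP; set x := v - v1 in A1 *.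
    rewrite w00 addr0 in A1; apply: (rdot_eq0 hH).
    have : dot (z *: x) x = dot x (z *: x) by move: (A1); rewrite -{1}hsa => h; exact: (h _ _ A1).
    have xE : dot x x = (rd x x)%:C%C by rewrite -hH normr_rnorm -rmorphXn (rnorm2 hH).
    rewrite linearZl_LR linearZr_LR /= xE; case: (z) z0 => a b /= b0 [] _.
    rewrite !mulr0 !add0r => /eqP; rewrite -subr_eq0 -mulrBl opprK mulf_eq0.
    by rewrite -mulr2n mulrn_eq0 (negbTE b0) => /eqP.
  exists s, (fun t => if t%:C%C != z then (t%:C%C - z)^-1 *: u t else 0); split => //.
    by move=> t; case: ifP => _; [exact: eigvecZ|exact: eigvec0].
  by rewrite v10 /v1 big_mkcond.
pose t0 := complex.Re z; have zE : z = t0%:C%C by rewrite /t0; case: (z) z0 => a b /= ->.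
have e0 : eigvec t0 w0.
  rewrite /eigvec /w0 scaler_sumr.
  have := opA_sum s (fun t => t%:C%C == z) eu; congr (A (_, _)).
  by apply: eq_bigr => t /eqP ->; rewrite zE.
have w00 : w0 = 0.
  apply: (rdot_eq0 hH); have := opA_sym hsa A1 e0.
  by rewrite zE (rdotDl _ (t0%:C%C *: _)) rdotZl rdotZr; lra.
rewrite w00 addr0 zE in A1.
(* The remainder v - [v1] becomes the component at [t0]; filtering keeps the list free of
   duplicates. *)
exists (t0 :: [seq t <- s | t != t0]),
  (fun t => if t == t0 then v - v1 else (t%:C%C - z)^-1 *: u t); split => /=.
- by rewrite mem_filter eqxx /= filter_uniq.
- by move=> t; case: eqVneq => [->|_] //; exact: eigvecZ.
rewrite big_cons eqxx big_filter.
rewrite (eq_bigr (fun t => (t%:C%C - z)^-1 *: u t)) => [|t /negbTE -> //].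
rewrite (eq_bigl (fun t : R => t%:C%C != z)); first by rewrite subrK.
by move=> t; rewrite zE (inj_eq (@complexI R)).
Qed.

Lemma eigen_sum0 : eigen_sum 0.
Proof. by exists [::], (fun=> 0); split => //; [move=> t; exact: eigvec0|rewrite big_nil]. Qed.

(* By Cayley-Hamilton, a product of operators A - z, with z ranging over the
   eigenvalues of the matrix M of A, vanishes on the span of the e i. *)
Lemma eigen_sum_finite (n : nat) (e : 'I_n.+1 -> H) (M : 'M[R[i]]_n.+1) :
  (forall i, A (e i, \sum_j M i j *: e j)) -> forall c : 'rV[R[i]]_n.+1,
  eigen_sum (\sum_i c 0 i *: e i).
Proof.
move=> AM; pose phi (c : 'rV[R[i]]_n.+1) := \sum_i c 0 i *: e i.
(* The e i may be linearly dependent: only the passage from rows of coefficients to vectors is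
   used. *)
have Aphi c : A (phi c, phi (c *m M)).
  have := opA_sum (index_enum 'I_n.+1) xpredT (fun i => opAZ hop (c 0 i) (AM i)).
  congr (A (_, _)); rewrite /phi.
  under eq_bigr do rewrite scaler_sumr; rewrite exchange_big /=; apply: eq_bigr => j _.
  by rewrite mxE scaler_suml; apply: eq_bigr => i _; rewrite scalerA.
suff main zs c : c *m \prod_(z <- zs) (M - z%:M) = 0 -> eigen_sum (phi c).
  move=> c; have [zs pE] := closed_field_poly_normal (char_poly M).
  apply: (main zs); have := Cayley_Hamilton M; rewrite pE.
  rewrite (monicP (char_poly_monic M)) scale1r rmorph_prod /= => h.
  rewrite (eq_bigr (fun z => horner_mx M ('X - z%:P))) => [|z _].
    by rewrite h mulmx0.
  by rewrite rmorphB /= horner_mx_X horner_mx_C.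
elim: zs c => [|z zs IH] c; rewrite ?big_nil ?big_cons.
  rewrite mulmx1 => ->; rewrite /phi big1; first exact: eigen_sum0.
  by move=> i _; rewrite mxE scale0r.
rewrite -mulmxE mulmxA => /IH h; apply: (eigen_sum_step (z := z) h).
have := Aphi c; congr (A (_, _)); rewrite mulmxBr mul_mx_scalar /phi scaler_sumr -big_split.
apply: eq_bigr => i _ /=; rewrite !mxE scalerDl scaleNr scalerA addrC subrK//.
Qed.

End Eigenvectors.

Section Diagonalization.
Variables (R : realType) (H : completeNormedModType R[i]) (dot : {dot H for Num.conj}).
Hypothesis hH : is_hilbert dot.
Variables (A : set (H * H)) (E : set R -> H -> H).
Hypotheses (hop : is_operator A) (hsa : self_adjoint dot A) (hd : dense (dom A)).
Hypothesis hK : compact_resolvent A.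
Hypothesis hE : is_spectral_measure dot A E.
Implicit Types (u v w : H) (S T : set R).
Local Notation rd := (rdot dot).
Local Notation eigvec := (eigvec A).

Lemma spectral_eigen_sum S (M : R) v : measurable S -> (forall t, S t -> `|t| <= M) ->
  E S v = v -> eigen_sum A v.
Proof.
move=> mS SM Sv.
have {}SM : forall t, S t -> `|t| <= `|M| by move=> t /SM /le_trans; apply; exact: ler_norm.
have [s sS sV] := spectral_finite hH hop hsa hd hE hK mS (normr_ge0 M) SM.
(* The extra zero vector makes the number of vectors a successor, as the matrix argument
   requires. *)
pose e (i : 'I_(size (0 :: s))) := (0 :: s)`_i.
have eS i : E S (e i) = e i.
  have : e i \in 0 :: s by apply: mem_nth; exact: ltn_ord.
  by rewrite inE => /predU1P[->|/sS//]; rewrite (bop0 (proj_bop (spectral_proj hE mS))).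
have span x : E S x = x -> exists c : 'I_(size s).+1 -> R[i], x = \sum_i c i *: e i.
  by move=> /sV h; apply: (rspan_sum (s := 0 :: s)); exists 0; rewrite scale0r subr0.
have ex i : exists c : 'I_(size s).+1 -> R[i], A (e i, \sum_j c j *: e j).
  have [w Aw] : dom A (e i) by rewrite -eS; exact: (spectral_bounded_dom hH hE _ mS SM).
  by have [c cw] := span w (spectral_stable hH hop hsa hd hE mS (eS i) Aw); exists c; rewrite -cw.
have [m hm] := boolp.choice ex.
have [c ->] := span v Sv.
have := @eigen_sum_finite _ _ _ hH A hop hsa _ e (\matrix_(i, j) m i j) _ (\row_i c i).
rewrite (eq_bigr (fun i => c i *: e i)) => [|i _]; last by rewrite mxE.
apply=> i; have := hm i; congr (A (_, _)).
by apply: eq_bigr => j _; rewrite mxE.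
Qed.

Let ball_itv (n : nat) : set R := `[- n%:R, n%:R]%classic.

(** Continuity from below of the scalar measure at v, together with |v - E v|^2 = |v|^2 - |E
    v|^2. *)
Lemma spectral_limit v (e : R) : 0 < e -> exists n, rnorm (v - E (ball_itv n) v) < e.
Proof.
move=> e0; have [mu [mu1 _ _]] := spectral_meas hE v.
have mb n : measurable (ball_itv n) by exact: measurable_itv.
have cup : \bigcup_n ball_itv n = setT.
  apply/seteqP; split => // t _; exists (Num.truncn `|t|).+1 => //=.
  by rewrite /ball_itv /= in_itv /= -ler_norml ltW// truncnS_gt.
have := @nondecreasing_cvg_mu _ _ _ mu ball_itv mb; rewrite cup.
move=> /(_ measurableT) cv; have {}cv : mu (ball_itv n) @[n --> \oo] --> mu setT.
  apply: cv; apply/nondecreasing_seqP => n; apply/subsetPset => t.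
  rewrite /ball_itv /= !in_itv /= -!ler_norml => /le_trans; apply.
  by rewrite ler_nat.
have : rd (E (ball_itv n) v) v @[n --> \oo] --> rd v v.
  have := cv; rewrite mu1// (spectral_T hE) => /fine_cvg; apply: cvg_trans.
  by apply: near_eq_cvg; apply: nearW => n; rewrite /= mu1.
move=> /cvgrPdist_lt /(_ (e ^+ 2)); rewrite exprn_gt0// => /(_ isT) [N _ hN].
exists N; rewrite ltNge (_ : (e <= _) = (e ^+ 2 <= rnorm (v - E (ball_itv N) v) ^+ 2)); last first.
  by rewrite ler_pXn2r// nnegrE ?rnorm_ge0 ?ltW.
rewrite -ltNge; have := hN N (leqnn N); apply: le_lt_trans.
rewrite (rnorm2 hH) (le_trans _ (ler_norm _))//.
rewrite (proj_rd hH (spectral_proj hE (mb N))) [X in _ <= X - _](proj_pyth hH (spectral_proj hE (mb N))); lra.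
Qed.

Lemma eigen_dense v (e : R) : 0 < e -> exists2 v', eigen_sum A v' & rnorm (v - v') < e.
Proof.
move=> /(spectral_limit v)[n hn]; exists (E (ball_itv n) v) => //.
have mb : measurable (ball_itv n) by exact: measurable_itv.
apply: (spectral_eigen_sum (M := n%:R) mb); last exact: (proj_idem (spectral_proj hE mb)).
by move=> t; rewrite /ball_itv /= in_itv /= -ler_norml.
Qed.

Lemma bop_sum (T : H -> H) (I : Type) (s : seq I) (u : I -> H) : bounded_op T ->
  T (\sum_(i <- s) u i) = \sum_(i <- s) T (u i).
Proof.
move=> bT; elim: s => [|i s IH]; first by rewrite !big_nil (bop0 bT).
by rewrite !big_cons (bopD bT) IH.
Qed.

(** On a finite sum of eigenvectors T multiplies orthogonal components by numbers of modulus at most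
    M, so Pythagoras gives the bound. Density extends it to all v, with the cruder bound [K] of T
    controlling the remainder. *)
Lemma eigen_bound (T : H -> H) (g : R -> R) (M : R) : bounded_op T -> 0 <= M ->
  (forall t v, eigvec t v -> T v = (g t)%:C%C *: v) -> (forall t, `|g t| <= M) ->
  forall v, rnorm (T v) <= M * rnorm v.
Proof.
move=> bT M0 hT gM v; have [K K0 hK'] := bop_bd bT.
have main v' : eigen_sum A v' -> rnorm (T v') <= M * rnorm v'.
  move=> [s [u [us eu ->]]]; rewrite (rnorm_le hH) ?mulr_ge0 ?rnorm_ge0//.
  rewrite (bop_sum _ _ bT) exprMn.
  under eq_bigr do rewrite (hT _ _ (eu _)).
  rewrite (eigen_sum_rd hsa us eu) (rnorm2 hH).
  have -> : rd (\sum_(t <- s) u t) (\sum_(t <- s) u t) = \sum_(t <- s) rd (u t) (u t).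
    have := eigen_sum_rd hsa us eu (fun=> 1).
    have -> : \sum_(t <- s) 1%:C%C *: u t = \sum_(t <- s) u t.
      by apply: eq_bigr => t _; rewrite scale1r.
    by move=> ->; apply: eq_bigr => t _; rewrite expr1n mul1r.
  rewrite mulr_sumr; apply: ler_sum => t _; rewrite ler_wpM2r ?(rdot_ge0 hH)//.
  by rewrite -real_normK ?num_real// ler_pXn2r ?nnegrE.
apply/ler_addgt0Pr => e e0.
have KM : 0 < K + M + 1 by rewrite ltr_wpDl// addr_ge0.
have [v' ev' hv'] := eigen_dense v (divr_gt0 e0 KM).
have vE : T v = T (v - v') + T v' by rewrite -(bopD bT) subrK.
have v'E : rnorm v' <= rnorm (v - v') + rnorm v by rewrite rnormC -{1}[v'](subrK v) rnormD.
rewrite vE; apply: (le_trans (rnormD _ _)).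
have h1 := hK' (v - v'); have h2 := main _ ev'.
have h3 : (K + M + 1) * rnorm (v - v') <= e by rewrite mulrC -ler_pdivlMr// ltW.
have h4 : M * rnorm v' <= M * (rnorm (v - v') + rnorm v) by rewrite ler_wpM2l.
have := rnorm_ge0 (v - v'); move: h1 h2 h3 h4; lra.
Qed.

Lemma eigen_ext (T : H -> H) : bounded_op T ->
  (forall t v, eigvec t v -> T v = 0) -> forall v, T v = 0.
Proof.
move=> bT hT v; apply: rnorm_eq0; apply/eqP; rewrite eq_le rnorm_ge0 andbT.
rewrite -(mul0r (rnorm v)); apply: (eigen_bound (g := fun=> 0)) => // [t w /hT ->|t].
  by rewrite scale0r.
by rewrite normr0.
Qed.

(** S is cut at t. The projection of v to either piece is again an eigenvector for t, but its scalar
    measure lives on one side of t and misses t. *)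
Lemma spectral_eig_out S t v : measurable S -> ~ S t -> eigvec t v -> E S v = 0.
Proof.
move=> mS St ev.
have null T : measurable T -> T `<=` S ->
    (forall x, T x -> t <= x) \/ (forall x, T x -> x <= t) -> E T v = 0.
  move=> mT TS cmp; have Aw := spectral_reduce hH hop hsa hd hE mT ev.
  rewrite (bopZ (proj_bop (spectral_proj hE mT))) in Aw.
  apply: (spectral_form_null hH hE mT (proj_idem (spectral_proj hE mT) v) Aw _ cmp).
    by move=> x /TS Sx; apply/eqP => xt; apply: St; rewrite -xt.
  by rewrite rdotZl.
have mI := measurableI _ _ mS (measurable_itv `]t, +oo[).
have mD := measurableI _ _ mS (measurable_itv `]-oo, t]).
have -> : S = (S `&` `]t, +oo[) `|` (S `&` `]-oo, t]).
  rewrite -setIUr (_ : _ `|` _ = setT) ?setIT//; apply/seteqP; split => // x _ /=.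
  by rewrite !in_itv /= andbT; case: (ltP t x) => h; [left|right].
rewrite (spectral_U hH hE)//.
- rewrite !null ?addr0//; try exact: subIsetl.
  + by right => x [_ /=]; rewrite in_itv.
  + by left => x [_ /=]; rewrite in_itv /= andbT => /ltW.
- apply/seteqP; split => // x [[_ /=]]; rewrite !in_itv /= andbT => tx [_].
  by rewrite leNgt tx.
Qed.

Lemma spectral_eig_in S t v : measurable S -> S t -> eigvec t v -> E S v = v.
Proof.
move=> mS St ev; rewrite -[RHS](spectral_C hH hE v mS).
by rewrite (spectral_eig_out (measurableC mS) (fun h => h St) ev) addr0.
Qed.

(** The range over the open interval is spanned by finitely many vectors, each a finite sum of
    eigenvectors; m is the largest modulus of the eigenvalues that occur. *)
Lemma spectral_open_closed (r : R) : 0 < r -> exists m : R, [/\ 0 <= m, m < r &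
  forall v, E `]- r, r[%classic v = v -> E `[- m, m]%classic v = v].
Proof.
move=> r0; set J := `]- r, r[%classic; have mJ : measurable J by exact: measurable_itv.
have JM t : J t -> `|t| <= r by rewrite /J /= in_itv /= -ltr_norml => /ltW.
have [s sJ sV] := spectral_finite hH hop hsa hd hE hK mJ (ltW r0) JM.
have step y : E J y = y -> exists2 m : R, 0 <= m < r &
    forall m', m <= m' -> E `[- m', m']%classic y = y.
  move=> Jy; have [l [u [ul eu yE]]] := spectral_eigen_sum mJ JM Jy.
  (* The decomposition may mention eigenvalues outside [J]; projecting it discards their
     components. *)
  have {}yE : y = \sum_(t <- l) E J (u t) by rewrite -Jy yE (bop_sum _ _ (proj_bop (spectral_proj hE mJ))).
  rewrite yE; elim: (l) => [|t l' [m /andP[m0 mr] IH]].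
    exists 0; rewrite ?lexx// => m' _; rewrite big_nil.
    by rewrite (bop0 (proj_bop (spectral_proj hE (measurable_itv _)))).
  have [tr|tr] := ltP `|t| r.
    exists (Num.max m `|t|); first by rewrite le_max m0 /= gt_max mr.
    move=> m'; rewrite ge_max => /andP[mm' tm']; rewrite big_cons.
    rewrite (bopD (proj_bop (spectral_proj hE (measurable_itv _)))) IH//; congr (_ + _).
    rewrite (spectral_eig_in mJ _ (eu t)); last by rewrite /J /= in_itv /= -ltr_norml.
    by apply: (spectral_eig_in _ _ (eu t)); [exact: measurable_itv|rewrite /= in_itv /= -ler_norml].
  exists m; rewrite ?m0// => m' mm'; rewrite big_cons (spectral_eig_out mJ _ (eu t)).
    by rewrite add0r IH.
  by rewrite /J /= in_itv /= -ltr_norml; apply/negP; rewrite -leNgt.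
have [m /andP[m0 mr] hm] : exists2 m : R, 0 <= m < r &
    forall y, y \in s -> E `[- m, m]%classic y = y.
  suff [m mr hm] : exists2 m : R, 0 <= m < r & forall y, y \in s ->
      forall m', m <= m' -> E `[- m', m']%classic y = y.
    by exists m => // y /hm; apply.
  elim: s sJ {sV} => [|y s IH] sJ; first by exists 0; rewrite ?lexx.
  have [m1 /andP[m10 m1r] h1] := step y (sJ _ (mem_head _ _)).
  have [|m2 /andP[m20 m2r] h2] := IH; first by move=> z zs; apply: sJ; rewrite inE zs orbT.
  exists (Num.max m1 m2); first by rewrite le_max m10 /= gt_max m1r.
  move=> z; rewrite inE => zs m'; rewrite ge_max => /andP[l1 l2].
  by case/predU1P: zs => [->|zs]; [exact: h1|exact: h2].
exists m; split => // v /sV.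
have bm := proj_bop (spectral_proj hE (measurable_itv (Interval (BLeft (- m)) (BRight m)))).
apply: (rspan_ind (Q := fun p => E `[- m, m]%classic p = p)) => //.
- by rewrite (bop0 bm).
- by move=> a p q hp hq; rewrite (bopD bm) (bopZ bm) hp hq.
Qed.

End Diagonalization.

(** * Bernstein approximation and the bounded transform *)

Section Bernstein.
Variable R : realType.
Implicit Types (x : R) (f g : nat -> R).

(* Recursive form of \sum_k 'C(n, k) x^k (1 - x)^(n - k) f k; it still makes sense
   for an operator in place of x. *)
Fixpoint bern x n f : R :=
  if n is n'.+1 then x * bern x n' (f \o succn) + (1 - x) * bern x n' f else f 0%N.

Lemma bern_le x n f g : 0 <= x <= 1 -> (forall k, f k <= g k) -> bern x n f <= bern x n g.
Proof.
move=> x01; elim: n f g => [|n IH] f g fg /=; first exact: fg.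
have /andP[x0 x1] := x01; apply: lerD; apply: ler_wpM2l; rewrite ?subr_ge0//; apply: IH => // k.
exact: fg.
Qed.

Lemma bern_affine x n f (a b : R) : bern x n (fun k => a + b * f k) = a + b * bern x n f.
Proof.
elim: n f => [//|n IH] f /=.
rewrite (_ : (fun k => a + b * f k) \o succn = fun k => a + b * (f \o succn) k)//.
by rewrite !IH; ring.
Qed.

(** The second moment about c of the binomial law with parameters n and x, as squared bias plus
    variance. The centre is arbitrary because the shift by [succn] moves it to c - 1 in the
    induction. *)
Lemma bern_variance x n (c : R) :
  bern x n (fun k => (k%:R - c) ^+ 2) = (n%:R * x - c) ^+ 2 + n%:R * x * (1 - x).
Proof.
elim: n c => [|n IH] c /=; first by ring.
rewrite (_ : _ \o succn = fun k => (k%:R - (c - 1)) ^+ 2); last first.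
  by apply/funext => k /=; rewrite -natr1; congr (_ ^+ 2); ring.
by rewrite !IH -[n.+1%:R]natr1; ring.
Qed.

Lemma bern_approx (q : R -> R) (L : R) : (forall x y, `|q x - q y| <= L * `|x - y|) ->
  forall e, 0 < e -> exists n, forall x, 0 <= x <= 1 ->
    `|bern x n (fun k => q (k%:R / n%:R)) - q x| <= e.
Proof.
move=> qL e e0; pose K := `|L| + 1; have K0 : 0 < K by rewrite ltr_wpDl.
have {}qL x y : `|q x - q y| <= K * `|x - y|.
  apply: (le_trans (qL x y)); apply: ler_wpM2r => //.
  by rewrite /K (le_trans (ler_norm L))// lerDl.
(* Chosen so that the variance term, at most K^2 / (2 e n), does not exceed e / 2. *)
pose n := (Num.truncn ((K / e) ^+ 2)).+1; exists n => x x01.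
have n0 : 0 < n%:R :> R by rewrite ltr0n.
have nK : (K / e) ^+ 2 <= n%:R by rewrite ltW// truncnS_gt.
(* With this b a deviation d = |k / n - x| costs b (k - n x)^2 = (K d)^2 / (2 e), a quadratic in k
   whose [bern] value is known. *)
pose b := K ^+ 2 / (2 * e * n%:R ^+ 2).
have b0 : 0 <= b by rewrite divr_ge0 ?sqr_ge0// !mulr_ge0 ?sqr_ge0// ltW.
have dev k : `|q (k%:R / n%:R) - q x| <= e / 2 + b * (k%:R - n%:R * x) ^+ 2.
  apply: (le_trans (qL _ _)); set d := `|_ - x|.
  have d2 : (k%:R - n%:R * x) ^+ 2 = n%:R ^+ 2 * d ^+ 2.
    by rewrite /d real_normK ?num_real//; field; rewrite gt_eqF.
  have -> : b * (k%:R - n%:R * x) ^+ 2 = (K * d) ^+ 2 / (2 * e).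
    by rewrite d2 /b; field; rewrite !gt_eqF.
  (* AM-GM: K d <= e / 2 + (K d)^2 / (2 e) *)
  rewrite -subr_ge0 (_ : _ - _ = (K * d - e) ^+ 2 / (2 * e)); last by field; rewrite gt_eqF.
  by rewrite divr_ge0 ?sqr_ge0// mulr_ge0// ltW.
have var : b * (n%:R * x * (1 - x)) <= e / 2.
  have x1 : x * (1 - x) <= 1 by case/andP: x01 => x0 x1; nra.
  rewrite -mulrA; apply: (@le_trans _ _ (b * (n%:R * 1))); first by rewrite !ler_wpM2l// ltW.
  rewrite (_ : b * _ = (K / e) ^+ 2 * (e / 2) / n%:R); last first.
    by rewrite /b; field; rewrite !gt_eqF.
  by rewrite ler_pdivrMr// mulrC ler_wpM2l// divr_ge0// ltW.
have cmp : bern x n (fun k => q x + (e / 2 + b * (k%:R - n%:R * x) ^+ 2)) =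
    q x + e / 2 + b * (n%:R * x * (1 - x)).
  rewrite (_ : (fun _ => _) = fun k => (q x + e / 2) + b * (k%:R - n%:R * x) ^+ 2).
    by rewrite bern_affine bern_variance subrr expr0n add0r.
  by apply/funext => k; rewrite addrA.
have cmp' : bern x n (fun k => q x - (e / 2 + b * (k%:R - n%:R * x) ^+ 2)) =
    q x - e / 2 - b * (n%:R * x * (1 - x)).
  rewrite (_ : (fun _ => _) = fun k => (q x - e / 2) + (- b) * (k%:R - n%:R * x) ^+ 2).
    by rewrite bern_affine bern_variance subrr expr0n add0r mulNr.
  by apply/funext => k; rewrite opprD addrA mulNr.
rewrite ler_distl; apply/andP; split.
  apply: (@le_trans _ _ (bern x n (fun k => q x - (e / 2 + b * (k%:R - n%:R * x) ^+ 2)))).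
    by rewrite cmp'; lra.
  by apply: bern_le => // k; have := dev k; rewrite ler_distl => /andP[].
apply: (@le_trans _ _ (bern x n (fun k => q x + (e / 2 + b * (k%:R - n%:R * x) ^+ 2)))).
  by apply: bern_le => // k; have := dev k; rewrite ler_distl => /andP[].
by rewrite cmp; lra.
Qed.

End Bernstein.

Section BoundedTransform.
Variable R : realType.
Implicit Types (t s a r : R).

Definition clamp a t : R := Num.max (- a) (Num.min t a).

Definition btransform t : R := t / Num.sqrt (1 + t ^+ 2).

Definition inv_btransform s : R := s / Num.sqrt (1 - s ^+ 2).

Lemma clampP a t : 0 <= a ->
  [\/ t <= - a /\ clamp a t = - a, - a <= t <= a /\ clamp a t = t | a <= t /\ clamp a t = a].
Proof.
move=> a0; rewrite /clamp; have [ta|ta] := leP t a; last first.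
  by constructor 3; split; [exact: ltW|rewrite max_r// lerNl; lra].
have [at_|at_] := leP (- a) t; first by constructor 2.
by constructor 1; split => //; exact: ltW.
Qed.

Lemma clamp_lip a t s : 0 <= a -> `|clamp a t - clamp a s| <= `|t - s|.
Proof.
move=> a0; rewrite ler_norml; have := ler_norm (t - s); have := ler_norm (s - t).
rewrite (distrC s t).
by case: (clampP t a0) => -[+ ->]; case: (clampP s a0) => -[+ ->]; move=> *; lra.
Qed.

Lemma clamp_lip_cutoff a b t : 0 <= a -> 0 <= b -> `|clamp a t - clamp b t| <= `|a - b|.
Proof.
move=> a0 b0; rewrite ler_norml; have := ler_norm (a - b); have := ler_norm (b - a).
rewrite (distrC b a).
by case: (clampP t a0) => -[+ ->]; case: (clampP t b0) => -[+ ->]; move=> *; lra.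
Qed.

Lemma sqrt1_gt0 t : 0 < Num.sqrt (1 + t ^+ 2).
Proof. by rewrite sqrtr_gt0 ltr_pwDl// sqr_ge0. Qed.

Lemma sub1_btransform2 t : 1 - btransform t ^+ 2 = (1 + t ^+ 2)^-1.
Proof.
have h : 0 < 1 + t ^+ 2 by rewrite ltr_pwDl// sqr_ge0.
rewrite /btransform expr_div_n sqr_sqrtr ?ltW//; field.
by rewrite gt_eqF.
Qed.

Lemma btransformK t : inv_btransform (btransform t) = t.
Proof.
rewrite /inv_btransform sub1_btransform2 sqrtrV; last by rewrite addr_ge0// sqr_ge0.
by rewrite invrK /btransform divfK// gt_eqF// sqrt1_gt0.
Qed.

Lemma btransformN t : btransform (- t) = - btransform t.
Proof. by rewrite /btransform sqrrN mulNr. Qed.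

Lemma btransform_lt1 t : `|btransform t| < 1.
Proof.
rewrite -(@ltr_pXn2r _ 2)// ?nnegrE// real_normK ?num_real// expr1n -subr_gt0 sub1_btransform2.
by rewrite invr_gt0 ltr_pwDl// sqr_ge0.
Qed.

Lemma btransform_ge0 t : 0 <= t -> 0 <= btransform t.
Proof. by move=> t0; rewrite divr_ge0// sqrtr_ge0. Qed.

Lemma btransform_homo t s : t <= s -> btransform t <= btransform s.
Proof.
have pos x y : 0 <= x -> x <= y -> btransform x <= btransform y.
  move=> x0 xy; have y0 := le_trans x0 xy.
  rewrite -(@ler_pXn2r _ 2)// ?nnegrE ?btransform_ge0//.
  have : 1 - btransform y ^+ 2 <= 1 - btransform x ^+ 2; last by lra.
  rewrite !sub1_btransform2 lef_pV2 ?posrE ?ltr_pwDl ?sqr_ge0// lerD2l.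
  by rewrite ler_pXn2r// nnegrE.
move=> ts; have [t0|t0] := leP 0 t; first exact: pos.
have [s0|s0] := leP 0 s.
  by apply: le_trans (btransform_ge0 s0); rewrite -oppr_ge0 -btransformN btransform_ge0// oppr_ge0 ltW.
by rewrite -lerN2 -!btransformN pos ?lerN2// oppr_ge0 ltW.
Qed.

(** Clamping commutes with the odd increasing function [btransform]. Thus [inv_btransform],
    unbounded near 1 and -1, is evaluated only on a compact part of (-1, 1), where it is
    Lipschitz. *)
Lemma clamp_btransform r t : 0 <= r -> inv_btransform (clamp (btransform r) (btransform t)) = clamp r t.
Proof.
move=> r0; suff -> : clamp (btransform r) (btransform t) = btransform (clamp r t) by exact: btransformK.
have b0 := btransform_ge0 r0; have bN := btransformN r.
case: (clampP t r0) => -[ht ->].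
- have := btransform_homo ht; rewrite bN.
  by case: (clampP (btransform t) b0) => -[ht' ->]; lra.
- case/andP: ht => /btransform_homo + /btransform_homo; rewrite bN.
  by case: (clampP (btransform t) b0) => -[ht' ->]; lra.
- have := btransform_homo ht.
  by case: (clampP (btransform t) b0) => -[ht' ->]; lra.
Qed.

Lemma inv_btransform_lip a : 0 <= a < 1 -> exists L, forall s t, `|s| <= a -> `|t| <= a ->
  `|inv_btransform s - inv_btransform t| <= L * `|s - t|.
Proof.
move=> /andP[a0 a1]; pose c := Num.sqrt (1 - a ^+ 2).
have c0 : 0 < c by rewrite sqrtr_gt0 subr_gt0 expr_lt1.
exists (c^-1 + (c ^+ 3)^-1) => s t sa ta.
have wc x : `|x| <= a -> c <= Num.sqrt (1 - x ^+ 2).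
  move=> xa; apply: ler_wsqrtr; rewrite lerD2l lerN2 -[x ^+ 2]real_normK ?num_real//.
  by rewrite ler_pXn2r// nnegrE.
have w2 x : `|x| <= a -> Num.sqrt (1 - x ^+ 2) ^+ 2 = 1 - x ^+ 2.
  move=> xa; rewrite sqr_sqrtr// subr_ge0 -[x ^+ 2]real_normK ?num_real//.
  by rewrite expr_le1// (le_trans xa)// ltW.
have := wc s sa; have := wc t ta; have := w2 s sa; have := w2 t ta; rewrite /inv_btransform.
set v := Num.sqrt (1 - t ^+ 2); set w := Num.sqrt (1 - s ^+ 2) => v2' w2' cv cw.
have v0 := lt_le_trans c0 cv; have w0 := lt_le_trans c0 cw.
(* v^2 - w^2 = s^2 - t^2 rationalizes the difference of the roots. As v and w are at least c, the
   two terms account for the constants 1 / c and 1 / c^3. *)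
have -> : s / w - t / v = (s - t) / w + t * ((s - t) * (s + t)) / (w * v * (v + w)).
  have -> : (s - t) * (s + t) = (v - w) * (v + w) by rewrite -!subr_sqr v2' w2'; ring.
  by field; rewrite !gt_eqF// addr_gt0.
apply: (le_trans (ler_normD _ _)); rewrite [leRHS]mulrDl lerD//.
  rewrite normrM mulrC ler_wpM2r// ger0_norm ?invr_ge0 ?(ltW w0)//.
  by rewrite lef_pV2.
rewrite !normrM (ger0_norm (_ : 0 <= (_)^-1)); last by rewrite invr_ge0 !mulr_ge0 ?addr_ge0 ?ltW.
have st : `|s + t| <= 2 by rewrite (le_trans (ler_normD _ _))//; lra.
have t1 : `|t| <= 1 by lra.
apply: (@le_trans _ _ (1 * (`|s - t| * 2) * (w * v * (v + w))^-1)).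
  rewrite ler_wpM2r ?invr_ge0 ?mulr_ge0 ?addr_ge0 ?(ltW v0) ?(ltW w0)//.
  by rewrite ler_pM ?mulr_ge0// ler_wpM2l.
rewrite mul1r -mulrA mulrC ler_wpM2r// ler_pdivrMr ?mulr_gt0 ?addr_gt0//.
rewrite -ler_pdivrMl ?invr_gt0 ?exprn_gt0// invrK.
have : c * c <= w * v by rewrite ler_pM// ltW.
move=> cc; have : (c * c) * (c + c) <= w * v * (v + w); last by rewrite exprS expr2; lra.
by rewrite ler_pM ?mulr_ge0 ?addr_ge0 ?lerD ?(ltW c0).
Qed.

(** n and f do not depend on t, so one Bernstein polynomial serves all eigenvalues of all operators
    in the family. The map s -> (1 + s) / 2 brings (-1, 1) into [0, 1]. *)
Lemma clamp_approx r : 0 <= r -> forall e, 0 < e -> exists n (f : nat -> R), forall t,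
  `|bern ((1 + btransform t) / 2) n f - clamp r t| <= e.
Proof.
move=> r0 e e0; have a0 := btransform_ge0 r0.
have a1 : btransform r < 1 by have := btransform_lt1 r; rewrite ger0_norm.
have [|L hL] := @inv_btransform_lip (btransform r); first by rewrite a0.
pose q x := inv_btransform (clamp (btransform r) (2 * x - 1)).
have cl x : `|clamp (btransform r) x| <= btransform r.
  by rewrite ler_norml; case: (clampP x a0) => -[+ ->]; lra.
have qL x y : `|q x - q y| <= (2 * `|L|) * `|x - y|.
  apply: (le_trans (hL _ _ (cl _) (cl _))).
  apply: (le_trans (ler_wpM2r (normr_ge0 _) (ler_norm L))).
  rewrite [2 * `|L|]mulrC -[leRHS]mulrA; apply: ler_wpM2l => //.
  apply: (le_trans (clamp_lip _ _ a0)).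
  have -> : 2 * x - 1 - (2 * y - 1) = 2 * (x - y) by ring.
  by rewrite normrM ger0_norm.
have [n hn] := bern_approx qL e0; exists n, (fun k => q (k%:R / n%:R)) => t.
have t01 : 0 <= (1 + btransform t) / 2 <= 1.
  by have := btransform_lt1 t; rewrite ltr_norml => /andP[? ?]; apply/andP; split; lra.
have := hn _ t01; rewrite /q (_ : 2 * _ - 1 = btransform t) ?clamp_btransform//.
by field.
Qed.

End BoundedTransform.

(** * The trivializing operator *)

Section Trivializing.
Variables (R : realType) (H : completeNormedModType R[i]) (dot : {dot H for Num.conj}).
Hypothesis hH : is_hilbert dot.
Variables (A : set (H * H)) (E : set R -> H -> H).
Hypotheses (hop : is_operator A) (hsa : self_adjoint dot A) (hd : dense (dom A)).
Hypothesis hcl : closed A.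
Hypothesis hK : compact_resolvent A.
Hypothesis hE : is_spectral_measure dot A E.
Implicit Types (u v w : H) (S T : set R).
Local Notation rd := (rdot dot).
Local Notation eigvec := (eigvec A).

Lemma spectral_orth S T u v : measurable S -> measurable T -> S `&` T = set0 ->
  E S u = u -> E T v = v -> rd u v = 0.
Proof.
move=> mS mT ST Su Tv; rewrite -Tv -(proj_sym hH (spectral_proj hE mT)) -Su.
by rewrite (spectral_disj hH hE)// ?rdot0l// setIC.
Qed.

Variables (r : R) (P : H -> H).
Hypotheses (r0 : 0 < r) (pP : projection dot P).
Let J : set R := `]- r, r[%classic.
Let Jp : set R := `[r, +oo[%classic.
Let Jm : set R := `]-oo, - r]%classic.
Hypothesis leP1 : op_le dot (E Jp) P.
Hypothesis leP2 : op_le dot P (E `]- r, +oo[%classic).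

Let mJ : measurable J. Proof. exact: measurable_itv. Qed.
Let mJp : measurable Jp. Proof. exact: measurable_itv. Qed.
Let mJm : measurable Jm. Proof. exact: measurable_itv. Qed.
Let bJ := proj_bop (spectral_proj hE mJ).
Let bP := proj_bop pP.

Let JJp : J `&` Jp = set0.
Proof.
apply/seteqP; split => // t []; rewrite /J /Jp /= !in_itv /= andbT => /andP[_ h].
by rewrite leNgt h.
Qed.

Let JJm : J `&` Jm = set0.
Proof.
apply/seteqP; split => // t []; rewrite /J /Jm /= !in_itv /= => /andP[h _].
by rewrite leNgt h.
Qed.

Let JpJm : Jp `&` Jm = set0.
Proof.
by apply/seteqP; split => // t []; rewrite /Jp /Jm /= !in_itv /= andbT; have := r0; lra.
Qed.

Let CJ : ~` J = Jp `|` Jm.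
Proof.
apply/seteqP; split => t; rewrite /J /Jp /Jm /= !in_itv /= andbT.
  by move/negP; rewrite negb_and -!leNgt => /orP[]; [right|left].
by case=> h; apply/negP; rewrite negb_and -!leNgt h ?orbT.
Qed.

Let JmE : Jm = ~` `]- r, +oo[%classic.
Proof.
apply/seteqP; split => t; rewrite /Jm /= !in_itv /= andbT; first by rewrite leNgt => /negP.
by move/negP; rewrite -leNgt.
Qed.

Lemma spectral_dec v : v = E J v + E Jp v + E Jm v.
Proof. by rewrite -addrA -(spectral_U hH hE)// -CJ (spectral_C hH hE). Qed.

Let op_leP (F G : H -> H) : op_le dot F G -> forall v, rd (F v) v <= rd (G v) v.
Proof. by move=> h v; have := h v; rewrite lecE => /andP[]. Qed.

(** |v|^2 = <E Jp v, v> <= <P v, v> = |P v|^2, and a projection that does not shorten v fixes it. *)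
Lemma P_fix v : E Jp v = v -> P v = v.
Proof.
move=> Ev; apply: (proj_fix hH pP); rewrite -(proj_rd hH pP).
by apply: le_trans (op_leP leP1 v); rewrite Ev.
Qed.

Lemma P_null v : E Jm v = v -> P v = 0.
Proof.
move=> Ev; apply: (rdot_eq0 hH); apply/eqP; rewrite eq_le rdot_ge0// andbT -(proj_rd hH pP).
apply: (le_trans (op_leP leP2 v)); rewrite -Ev (spectral_disj hH hE) ?rdot0l//.
by rewrite JmE setICr.
Qed.

(** For x in ran (E J), symmetry of P with [P_fix] and [P_null] makes P x orthogonal to the ranges
    over [Jp] and [Jm], so P preserves ran (E J). A symmetric operator that preserves the range of a
    projection commutes with it. *)
Lemma P_comm v : P (E J v) = E J (P v).
Proof.
have st x : E J x = x -> E J (P x) = P x.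
  move=> Jx; rewrite {2}(spectral_dec (P x)).
  have -> : E Jp (P x) = 0.
    apply: (eq_dotr hH) => w; rewrite rdot0r rdotC (proj_sym hH (spectral_proj hE mJp)) (proj_sym hH pP).
    rewrite P_fix ?(proj_idem (spectral_proj hE mJp))//.
    by apply: (spectral_orth mJ mJp) => //; exact: (proj_idem (spectral_proj hE mJp)).
  have -> : E Jm (P x) = 0.
    apply: (eq_dotr hH) => w; rewrite rdot0r rdotC (proj_sym hH (spectral_proj hE mJm)) (proj_sym hH pP).
    by rewrite P_null ?rdot0r ?(proj_idem (spectral_proj hE mJm)).
  by rewrite !addr0.
apply: (eq_dotr hH) => w.
rewrite -(st _ (proj_idem (spectral_proj hE mJ) v)) -!(proj_sym hH (spectral_proj hE mJ)) -!(proj_sym hH pP).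
by rewrite -(proj_sym hH (spectral_proj hE mJ)) (st _ (proj_idem (spectral_proj hE mJ) w)).
Qed.

Lemma P_split v : P v = E Jp v + P (E J v).
Proof.
rewrite {1}(spectral_dec v) !(bopD bP) (P_fix (proj_idem (spectral_proj hE mJp) v)).
by rewrite (P_null (proj_idem (spectral_proj hE mJm) v)) addr0 addrC.
Qed.

(** The reflection 2P - 1, a self-adjoint involution. *)
Definition refl_proj v := P v - (v - P v).

Lemma bop_refl_proj : bounded_op refl_proj.
Proof. by apply: bop_sub => //; apply: bop_sub => //; exact: bop_id. Qed.

Lemma refl_projK v : refl_proj (refl_proj v) = v.
Proof.
have e : P (refl_proj v) = P v by rewrite /refl_proj !(bopB bP) (proj_idem pP) subrr subr0.
by rewrite {1}/refl_proj e opprB /refl_proj opprB [X in _ + X]addrC subrK addrC subrK.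
Qed.

Lemma refl_proj_sym u v : rd (refl_proj u) v = rd u (refl_proj v).
Proof. by rewrite /refl_proj !rdotBl !rdotBr (proj_sym hH pP). Qed.

Lemma refl_proj_comm v : refl_proj (E J v) = E J (refl_proj v).
Proof. by rewrite /refl_proj !(bopB bJ) P_comm. Qed.

Lemma refl_proj_isometry v : rd (refl_proj v) (refl_proj v) = rd v v.
Proof. by rewrite refl_proj_sym refl_projK. Qed.

Lemma A_on_J : exists B : H -> H, forall v, A (E J v, B v).
Proof.
have h v : exists w, A (E J v, w).
  apply: (spectral_bounded_dom (S := J) (M := r) hH hE) => // t.
  by rewrite /J /= in_itv /= -ltr_norml => /ltW.
by have [B hB] := boolp.choice h; exists B.
Qed.

(* B is the bounded operator A E(J). *)
Variable B : H -> H.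
Hypothesis hB : forall v, A (E J v, B v).

Lemma B_uniq v w : E J v = v -> A (v, w) -> B v = w.
Proof. by move=> Jv; apply: (opA_uniq hop); rewrite -{1}Jv; exact: hB. Qed.

Lemma BJ v : B (E J v) = B v.
Proof. by apply: B_uniq; [exact: (proj_idem (spectral_proj hE mJ))|exact: hB]. Qed.

Lemma JB v : E J (B v) = B v.
Proof. exact: (spectral_stable hH hop hsa hd hE mJ (proj_idem (spectral_proj hE mJ) v) (hB v)). Qed.

(** Estimating on [J] itself would give only r, hence a weak inequality for the norm of C; [-m, m]
    carries the same range and makes it strict. *)
Lemma B_norm : exists m, [/\ 0 <= m, m < r & forall v, rnorm (B v) <= m * rnorm v].
Proof.
have [m [m0 mr hm]] := spectral_open_closed hH hop hsa hd hK hE r0.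
exists m; split => // v; apply: (@le_trans _ _ (m * rnorm (E J v))).
  apply: (spectral_norm (S := `[- m, m]%classic) hH hop hsa hd hE) (hB v) => //.
    by move=> t; rewrite /= in_itv /= -ler_norml.
  by apply: hm; exact: (proj_idem (spectral_proj hE mJ)).
by rewrite ler_wpM2l// (rnorm_sqr_le hH) (proj_le hH (spectral_proj hE mJ)).
Qed.

Lemma bop_B : bounded_op B.
Proof.
apply/bounded_opP; split; last by have [m [m0 _ hm]] := B_norm; exists m.
move=> a u v; rewrite -BJ; apply: B_uniq; first exact: (proj_idem (spectral_proj hE mJ)).
by rewrite (bopD bJ) (bopZ bJ); exact: opA_lin.
Qed.

Lemma B_sym u v : rd (B u) v = rd u (B v).
Proof.
rewrite -JB (proj_sym hH (spectral_proj hE mJ)) (opA_sym hsa (hB u) (hB v)).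
by rewrite (proj_sym hH (spectral_proj hE mJ)) JB.
Qed.

Definition trivop v : H := r%:C%C *: refl_proj (E J v) - B v.

Local Notation C := trivop.

Lemma bop_trivop : bounded_op C.
Proof.
apply: bop_sub bop_B; apply: bop_scale.
exact: (bop_comp bop_refl_proj bJ).
Qed.

Lemma trivop_sym u v : rd (C u) v = rd u (C v).
Proof.
rewrite /trivop rdotBl rdotBr rdotZl rdotZr B_sym; congr (r * _ - _).
by rewrite refl_proj_sym (proj_sym hH (spectral_proj hE mJ)) refl_proj_comm.
Qed.

Lemma trivop_norm : opnorm C < 2 * r.
Proof.
have [m [m0 mr hm]] := B_norm; apply: (@le_lt_trans _ _ (r + m)); last by lra.
apply: (opnorm_le bop_trivop); first by rewrite addr_ge0// ltW.
move=> v; apply: (le_trans (rnormB _ _)); rewrite mulrDl lerD//.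
rewrite rnormZr gtr0_norm// ler_pM2l// (rnorm_sqr_le hH) refl_proj_isometry.
exact: (proj_le hH (spectral_proj hE mJ)).
Qed.

Lemma trivop_range : range C `<=` range (E J).
Proof.
move=> _ [v _ <-]; exists (C v) => //.
by rewrite /trivop (bopB bJ) (bopZ bJ) -refl_proj_comm (proj_idem (spectral_proj hE mJ)) JB.
Qed.

Lemma trivop_finite : finite_dimensional (range C).
Proof.
have [|s _ hs] := spectral_finite hH hop hsa hd hE hK mJ (ltW r0).
  by move=> t; rewrite /J /= in_itv /= -ltr_norml => /ltW.
exists (size s), (fun i => s`_i) => v /trivop_range [u _ <-].
have [c ->] := rspan_sum (hs _ (proj_idem (spectral_proj hE mJ) u)).
by exists c.
Qed.

Lemma trivop_in v w : E J v = v -> A (v, w) -> C v = r%:C%C *: refl_proj v - w.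
Proof. by move=> Jv Aw; rewrite /trivop Jv (B_uniq Jv Aw). Qed.

Lemma trivop_out v : E J v = 0 -> C v = 0.
Proof.
move=> Jv; rewrite /trivop -BJ Jv (bop0 bop_refl_proj) scaler0.
by rewrite (bop0 bop_B) subr0.
Qed.

Lemma trivop_clamp t v : eigvec t v -> r%:C%C *: refl_proj v - C v = (clamp r t)%:C%C *: v.
Proof.
move=> ev; have [[tr ->]|[tr ->]|[tr ->]] := clampP t (ltW r0).
- have Jmv : E Jm v = v by apply: (spectral_eig_in hH hop hsa hd hE mJm) ev; rewrite /Jm /= in_itv.
  rewrite trivop_out ?subr0; last by rewrite -Jmv (spectral_disj hH hE).
  by rewrite /refl_proj P_null// subr0 sub0r scalerN rmorphN scaleNr.
- have [Jt|Jt] := pselect (J t).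
    have Jv := spectral_eig_in hH hop hsa hd hE mJ Jt ev.
    by rewrite (trivop_in Jv ev) opprB addrC subrK.
  rewrite trivop_out ?subr0; last exact: (spectral_eig_out hH hop hsa hd hE mJ Jt ev).
  (* The middle case of [clampP] is closed while [J] is open, so the two endpoints remain. *)
  have : t = r \/ t = - r.
    have : (Jp `|` Jm) t by rewrite -CJ.
    by rewrite /Jp /Jm /= !in_itv /= andbT => -[h|h]; [left|right]; lra.
  case=> te.
    have Jv : E Jp v = v.
      by apply: (spectral_eig_in hH hop hsa hd hE mJp) ev; rewrite /Jp /= in_itv /= te lexx.
    by rewrite /refl_proj P_fix// subrr subr0 te.
  have Jv : E Jm v = v.
    by apply: (spectral_eig_in hH hop hsa hd hE mJm) ev; rewrite /Jm /= in_itv /= te lexx.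
  by rewrite /refl_proj P_null// subr0 sub0r scalerN te rmorphN scaleNr.
- have Jpv : E Jp v = v.
    by apply: (spectral_eig_in hH hop hsa hd hE mJp) ev; rewrite /Jp /= in_itv /= tr.
  rewrite trivop_out ?subr0; last by rewrite -Jpv (spectral_disj hH hE).
  by rewrite /refl_proj P_fix// subrr subr0.
Qed.

Let AC := op_add A (graph C).

Lemma trivop_sumP v w : AC (v, w) <-> A (v, w - C v).
Proof.
split=> [[a [b [/= Aa]]]|h]; first by rewrite /graph /= => -> ->; rewrite addrK.
by exists (w - C v), (C v); split => //=; rewrite subrK.
Qed.

Lemma trivop_sum_op : is_operator AC.
Proof.
split.
- by apply/trivop_sumP; rewrite (bop0 bop_trivop) subr0; exact: opA0.
- move=> a v w v' w' /trivop_sumP h /trivop_sumP h'; apply/trivop_sumP; have := opA_lin hop a h h'.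
  by congr (A (_, _)); rewrite (bopD bop_trivop) (bopZ bop_trivop) scalerBr addrACA -opprD.
- by move=> v w w' /trivop_sumP h /trivop_sumP /(opA_uniq hop h) /addIr.
Qed.

Lemma trivop_sum_sym v w v' w' : AC (v, w) -> AC (v', w') -> rd w v' = rd v w'.
Proof.
move=> /trivop_sumP h /trivop_sumP /(opA_sym hsa h); rewrite rdotBl rdotBr trivop_sym; lra.
Qed.

Lemma trivop_sum_real v w : AC (v, w) -> dot w v = (rd w v)%:C%C.
Proof.
move=> h; rewrite dotE; congr (_ +i* _)%C.
have := trivop_sum_sym h (opAZ trivop_sum_op 'i%C h).
by rewrite -Im_dot -Im_dot dot_conj; case: (dot v w) => x y /=; lra.
Qed.

Lemma trivop_sum_in x : E J x = x -> AC (x, r%:C%C *: refl_proj x).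
Proof.
move=> Jx; apply/trivop_sumP; have := hB x; rewrite Jx.
by rewrite /trivop Jx subKr.
Qed.

Let refl_proj_split v : refl_proj v = refl_proj (E J v) + E Jp v - E Jm v.
Proof.
rewrite /refl_proj (P_split v); apply: (eq_dotr hH) => w; rewrite !(rdotBr, rdotDr).
by have := congr1 (rd w) (spectral_dec v); rewrite !rdotDr; lra.
Qed.

(* Pair (A + C) v with (2P - 1) v, which has the norm of v. *)
Lemma trivop_sum_below v w : AC (v, w) -> r * rnorm v <= rnorm w.
Proof.
move=> /trivop_sumP Aa; set a := w - C v in Aa.
have E1 := spectral_reduce hH hop hsa hd hE mJp Aa; have E2 := spectral_reduce hH hop hsa hd hE mJm Aa.
have E3 := spectral_reduce hH hop hsa hd hE mJ Aa.
have Ba : E J a = B v by exact: (opA_uniq hop E3 (hB v)).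
have Jv := proj_idem (spectral_proj hE mJ) v; have Jpv := proj_idem (spectral_proj hE mJp) v.
have Jmv := proj_idem (spectral_proj hE mJm) v; have Jpa := proj_idem (spectral_proj hE mJp) a.
have Jma := proj_idem (spectral_proj hE mJm) a.
have JS : E J (refl_proj (E J v)) = refl_proj (E J v) by rewrite -refl_proj_comm Jv.
have wE : w = r%:C%C *: refl_proj (E J v) + E Jp a + E Jm a.
  have -> : w = a + C v by rewrite /a subrK.
  by rewrite {1}(spectral_dec a) Ba /trivop; apply: (eq_dotr hH) => x; rewrite !(rdotBr, rdotDr); ring.
have fp : r * rd (E Jp v) (E Jp v) <= rd (E Jp a) (E Jp v).
  by apply: (spectral_form_ge hH hE mJp Jpv E1) => t; rewrite /Jp /= in_itv /= andbT.
have fm : rd (E Jm a) (E Jm v) <= (- r) * rd (E Jm v) (E Jm v).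
  by apply: (spectral_form_le hH hE mJm Jmv E2) => t; rewrite /Jm /= in_itv.
have JpJ : Jp `&` J = set0 by rewrite setIC. have JmJ : Jm `&` J = set0 by rewrite setIC.
have JmJp : Jm `&` Jp = set0 by rewrite setIC.
have main : r * rd v v <= rd w (refl_proj v).
  move: JS wE (refl_proj_split v) (refl_proj_isometry (E J v)); move: (refl_proj (E J v)) => x JS wE -> xx.
  rewrite wE {1 2}(spectral_dec v) !(rdotDl, rdotDr, rdotNr) !rdotZl xx.
  rewrite (spectral_orth mJ mJp JJp Jv Jpv) (spectral_orth mJ mJm JJm Jv Jmv).
  rewrite (spectral_orth mJp mJ JpJ Jpv Jv) (spectral_orth mJp mJm JpJm Jpv Jmv).
  rewrite (spectral_orth mJm mJ JmJ Jmv Jv) (spectral_orth mJm mJp JmJp Jmv Jpv).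
  rewrite (spectral_orth mJ mJp JJp JS Jpv) (spectral_orth mJ mJm JJm JS Jmv).
  rewrite (spectral_orth mJp mJ JpJ Jpa JS) (spectral_orth mJp mJm JpJm Jpa Jmv).
  rewrite (spectral_orth mJm mJ JmJ Jma JS) (spectral_orth mJm mJp JmJp Jma Jpv).
  by move: fp fm; lra.
have [v0|v0] := eqVneq (rnorm v) 0; first by rewrite v0 mulr0 rnorm_ge0.
have vp : 0 < rnorm v by rewrite lt_neqAle eq_sym v0 rnorm_ge0.
rewrite -(ler_pM2r vp) -mulrA -expr2 (rnorm2 hH); apply: (le_trans main).
apply: (le_trans (rdot_CS hH _ _)); rewrite ler_wpM2l ?rnorm_ge0// (rnorm_sqr_le hH).
by rewrite refl_proj_isometry.
Qed.

(** An eigenvector for t is solved for separately: the inverse of A + C on it is (2P - 1) / r if t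
    lies in [J] and 1 / t otherwise. *)
Lemma trivop_sum_eigen w : eigen_sum A w -> exists v, AC (v, w).
Proof.
move=> [s [u [us eu ->]]].
have h t : exists v, AC (v, u t).
  have [Jt|Jt] := pselect (J t).
    have Ju := spectral_eig_in hH hop hsa hd hE mJ Jt (eu t).
    exists (r^-1%:C%C *: refl_proj (u t)).
    have := @trivop_sum_in (r^-1%:C%C *: refl_proj (u t)); rewrite (bopZ bJ) -refl_proj_comm Ju => /(_ erefl).
    by rewrite (bopZ bop_refl_proj) refl_projK scalerA -rmorphM /= mulfV ?gt_eqF// scale1r.
  have Cu := trivop_out (spectral_eig_out hH hop hsa hd hE mJ Jt (eu t)).
  have t0 : t != 0.
    by apply: contra_notN Jt => /eqP ->; rewrite /J /= in_itv /= oppr_lt0 r0.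
  exists (t^-1%:C%C *: u t); apply/trivop_sumP; rewrite (bopZ bop_trivop) Cu scaler0 subr0.
  have := opAZ hop (t^-1)%:C%C (eu t); rewrite scalerA -rmorphM /= mulVf// scale1r.
  exact.
have [f hf] := boolp.choice h; exists (\sum_(t <- s) f t).
exact: (opA_sum trivop_sum_op).
Qed.

(** The range is dense by [trivop_sum_eigen]. The lower bound [trivop_sum_below] makes preimages of
    a convergent sequence Cauchy, and A is closed. *)
Lemma trivop_sum_surj w : exists v, AC (v, w).
Proof.
have app n : exists p, AC p /\ rnorm (w - p.2) < n.+1%:R^-1.
  have n0 : 0 < n.+1%:R^-1 :> R by rewrite invr_gt0.
  have [w' /trivop_sum_eigen[v ACv] ww'] := eigen_dense hH hop hsa hd hK hE w n0.
  by exists (v, w').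
have [p hp] := boolp.choice app.
have small e : 0 < e -> exists N, forall n, (N <= n)%N -> rnorm (w - (p n).2) < e :> R.
  move=> e0; exists (Num.truncn e^-1) => n Nn; apply: (lt_le_trans (hp n).2).
  rewrite invf_ple ?posrE// ltW//; apply: (lt_le_trans (truncnS_gt _)).
  by rewrite ler_nat.
have [l hl] : exists l, forall e : R, 0 < e ->
    exists N, forall n, (N <= n)%N -> rnorm (l - (p n).1) < e.
  apply: cauchy_nr => e e0; have [|N hN] := small (r * e / 2).
    by rewrite divr_gt0// mulr_gt0.
  exists N => m n Nm Nn; have hm := hp m; have hn := hp n.
  have ACd : AC ((p m).1 - (p n).1, (p m).2 - (p n).2).
    by apply: (opAB trivop_sum_op); rewrite -surjective_pairing; [exact: hm.1|exact: hn.1].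
  rewrite -(ltr_pM2l r0); apply: (le_lt_trans (trivop_sum_below ACd)).
  apply: (le_lt_trans (rnorm_tri w _ _)); have := hN m Nm; have := hN n Nn.
  by rewrite (rnormC w (p m).2); lra.
exists l; apply/trivop_sumP; apply: (closed_graph_nr hcl) => e e0.
have [K K0 hK'] := bop_bd bop_trivop.
have K1 : 0 < K + 1 by rewrite ltr_wpDl.
have [N1 h1] := small (e / 2) (divr_gt0 e0 (@ltr0Sn R 1)).
have [|N2 h2] := hl (e / 2 / (K + 1)); first by rewrite !divr_gt0.
set n := maxn N1 N2; exists (p n).1, ((p n).2 - C (p n).1).
have {}h1 := h1 n (leq_maxl _ _); have {}h2 := h2 n (leq_maxr _ _).
have d0 := rnorm_ge0 (l - (p n).1).
have h3 : (K + 1) * rnorm (l - (p n).1) < e / 2 by rewrite mulrC -ltr_pdivlMr.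
split.
- by apply/trivop_sumP; rewrite -surjective_pairing; exact: (hp n).1.
- have : 0 <= K * rnorm (l - (p n).1) by rewrite mulr_ge0.
  by move: h3; lra.
have -> : w - C l - ((p n).2 - C (p n).1) = (w - (p n).2) - C (l - (p n).1).
  by rewrite (bopB bop_trivop); apply: (eq_dotr hH) => x; rewrite !(rdotBr, rdotDr); ring.
apply: (le_lt_trans (rnormB _ _)); have := hK' (l - (p n).1); move: h3 h1; lra.
Qed.

Lemma trivop_sum_invertible : invertible AC.
Proof.
have [T hT] := boolp.choice trivop_sum_surj.
have inj v v' w : AC (v, w) -> AC (v', w) -> v = v'.
  move=> h /(opAB trivop_sum_op h); rewrite subrr => /trivop_sum_below; rewrite rnorm0 => le0.
  apply/eqP; rewrite -subr_eq0; apply/eqP/rnorm_eq0/eqP; rewrite eq_le rnorm_ge0 andbT.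
  by rewrite -(ler_pM2l r0) mulr0.
exists T.
  apply/bounded_opP; split.
    by move=> a u v; apply: (inj _ _ _ (hT _)); exact: (opA_lin trivop_sum_op).
  exists r^-1; first by rewrite invr_ge0 ltW.
  by move=> v; rewrite ler_pdivlMl//; exact: trivop_sum_below.
apply/seteqP; split=> -[w v] /=; rewrite /op_inv /graph /=.
  by move=> h; exact: inj h (hT w).
by move=> ->; exact: hT.
Qed.

(* A + C has the spectral measure of A off J, and the eigenvalues r and -r on
   ran (E J). *)
Definition trivop_measure S v : H := E (S `\` J) v + (if r \in S then P (E J v) else 0) +
  (if - r \in S then E J v - P (E J v) else 0).

(** Of the two atoms only r is nonnegative, and removing [J] from [0, +oo) leaves [Jp], where P is
    the identity. *)
Lemma trivop_measure_ge0 : P = trivop_measure `[0, +oo[%classic.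
Proof.
apply/funext => v; rewrite /trivop_measure mem_set; last by rewrite /= in_itv /= andbT ltW.
rewrite memNset; last by rewrite /= in_itv /= andbT; apply/negP; rewrite -ltNge oppr_lt0.
rewrite addr0 P_split; congr (E _ _ + _); apply/seteqP; split => t; rewrite /J /Jp /= !in_itv /= !andbT.
  by move=> rt; split; [by have := r0; lra|apply/negP; rewrite negb_and -!leNgt rt orbT].
by case=> t0 /negP; rewrite negb_and -!leNgt => /orP[|//]; have := r0; lra.
Qed.

Lemma trivop_spectral : is_spectral_measure dot AC trivop_measure.
Proof.
have mD S : measurable S -> measurable (S `\` J) by move=> mS; exact: measurableD.
have DJ S : (S `\` J) `&` J = set0 by apply/seteqP; split => // t [[]].
have JD S : J `&` (S `\` J) = set0 by rewrite setIC.
have PP v : P (P (E J v)) = P (E J v) by exact: (proj_idem pP).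
have JP v : E J (P (E J v)) = P (E J v) by rewrite -P_comm (proj_idem (spectral_proj hE mJ)).
have DP S v : measurable S -> E (S `\` J) (P (E J v)) = 0.
  by move=> mS; rewrite -JP (spectral_disj hH hE) //; exact: mD.
have DE S v : measurable S -> E (S `\` J) (E J v) = 0.
  by move=> mS; rewrite (spectral_disj hH hE) //; exact: mD.
have JDE S v : measurable S -> E J (E (S `\` J) v) = 0.
  by move=> mS; rewrite (spectral_disj hH hE) //; exact: mD.
have symPE u v : rd (P (E J u)) v = rd u (P (E J v)).
  by rewrite (proj_sym hH pP) (proj_sym hH (spectral_proj hE mJ)) -P_comm.
have pE S : measurable S -> projection dot (trivop_measure S).
  move=> mS; have bD := proj_bop (spectral_proj hE (mD S mS)); apply: projP => //.
  - rewrite /trivop_measure; apply: bop_add; first (apply: bop_add; first exact: bD).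
    + case: (r \in S); first exact: (bop_comp bP bJ).
      by have := bop_scale 0 (bop_id H); congr bounded_op; apply/funext => v; rewrite scale0r.
    + case: (- r \in S); first by apply: bop_sub => //; exact: (bop_comp bP bJ).
      by have := bop_scale 0 (bop_id H); congr bounded_op; apply/funext => v; rewrite scale0r.
  - move=> u v; rewrite /trivop_measure !rdotDl !rdotDr (proj_sym hH (spectral_proj hE (mD S mS))).
    congr (_ + _ + _); case: ifP => _; rewrite ?rdot0l ?rdot0r//.
    by rewrite rdotBl rdotBr symPE (proj_sym hH (spectral_proj hE mJ)).
  - move=> v; rewrite /trivop_measure.
    have ED : E (S `\` J) (trivop_measure S v) = E (S `\` J) v.
      rewrite /trivop_measure !(bopD bD) (proj_idem (spectral_proj hE (mD S mS))).
      by do 2! case: ifP => _; rewrite ?(bopB bD) ?DP ?DE ?(bop0 bD) ?subrr ?addr0.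
    have EJ : E J (trivop_measure S v) = (if r \in S then P (E J v) else 0) +
        (if - r \in S then E J v - P (E J v) else 0).
      rewrite /trivop_measure !(bopD bJ) JDE// add0r.
      by congr (_ + _); case: ifP => _; rewrite ?(bopB bJ) ?JP ?(proj_idem (spectral_proj hE mJ)) ?(bop0 bJ).
    rewrite -/(trivop_measure S v) ED EJ /trivop_measure.
    case: (r \in S); case: (- r \in S); rewrite ?(bopD bP, bopN bP, bop0 bP, PP);
      by apply: (eq_dotr hH) => w; rewrite ?(rdotDr, rdotNr, rdot0r); ring.
split => //.
  move=> v; rewrite /trivop_measure !mem_set// setTD -addrA [P _ + _]addrC subrK addrC.
  exact: (spectral_C hH hE).
move=> v; set v2 := E (~` J) v.
have [mu [mu1 mu2 mu3]] := spectral_meas hE v2.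
have mC : measurable (~` J) by exact: measurableC.
have q1 := rdot_ge0 hH (P (E J v)); have q2 := rdot_ge0 hH (E J v - P (E J v)).
(* The measure of A at the component [v2] outside [J], plus atoms at r and -r weighted by the
   squared norms of the parts of E J v in ran P and in its complement. *)
pose nu := measure_add mu (measure_add (dmass r q1) (dmass (- r) q2)).
exists nu.
have A1 := hB v.
have vE : v = E J v + v2 by rewrite (spectral_C hH hE).
(* ran (E J) lies in the domain and C is everywhere defined, so only [v2] matters. Correspondingly,
   the atoms do not affect finiteness of the second moment. *)
have domE : dom AC v <-> dom A v2.
  split=> [[w /trivop_sumP Aw]|[w2 Aw2]].
    by exists (E (~` J) (w - C v)); exact: (spectral_reduce hH hop hsa hd hE mC Aw).
  exists (B v + w2 + C v); apply/trivop_sumP; rewrite addrK {1}vE; exact: (opAD hop).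
have v2C : E (~` J) v2 = v2 := proj_idem (spectral_proj hE mC) v.
have pv : rd (P (E J v)) v = rd (P (E J v)) (P (E J v)).
  by rewrite [RHS]symPE JP PP rdotC.
have ev : rd (E J v - P (E J v)) v = rd (E J v - P (E J v)) (E J v - P (E J v)).
  have e1 : rd (P (E J v)) (E J v) = rd (P (E J v)) v.
    by rewrite -(proj_sym hH (spectral_proj hE mJ)) JP.
  rewrite !rdotBl !rdotBr (rdotC dot (E J v) (P _)) e1 -pv.
  by rewrite -(proj_rd hH (spectral_proj hE mJ)); ring.
split.
- move=> S mS; transitivity (mu S + (dmass r q1 S + dmass (- r) q2 S))%E.
    by rewrite -(measure_addE (dmass r q1)) -(measure_addE mu).
  rewrite mu1// !dmassE -!EFinD; congr EFin.
  have tE : rd (trivop_measure S v) v = rd (E (S `\` J) v) v + (rd (if r \in S then P (E J v) else 0) v +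
      rd (if - r \in S then E J v - P (E J v) else 0) v) by rewrite addrA -!rdotDl.
  rewrite -[RHS]/(rd (trivop_measure S v) v) tE; congr (_ + _).
    rewrite /v2 (spectral_I hH hE)// -setDE -(proj_sym hH (spectral_proj hE mC)) (spectral_subl hH hE)//.
      exact: mD.
  by case: (r \in S); case: (- r \in S); rewrite ?rdot0l ?pv ?ev.
- have q12 := sqint_measure_add_lty (dmass r q1) (dmass (- r) q2).
  have nuq := sqint_measure_add_lty mu (measure_add (dmass r q1) (dmass (- r) q2)).
  rewrite domE mu2; split=> [h|h]; last by case: (nuq.1 h).
  by apply: (nuq.2 _); split => //; apply: (q12.2 _); split; exact: dmass_sqint.
move=> w ACw; rewrite (trivop_sum_real ACw); congr (_%:C)%C.
have /trivop_sumP Aa := ACw; set a := w - C v in Aa.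
have A2 := spectral_reduce hH hop hsa hd hE mC Aa; rewrite -/v2 in A2.
have sq : (\int[mu]_t ((t : R) ^+ 2)%:E < +oo)%E by apply/mu2; exists (E (~` J) a).
have sq12 := dmass_sqint r q1; have sq22 := dmass_sqint (- r) q2.
rewrite Rint_measure_add ?Rint_measure_add ?dmass_int ?measure_add_lty ?dmass_lty//; last 2 first.
- exact: (spectral_meas_lty mu1).
- exact/sqint_measure_add_lty.
rewrite -(mu3 _ A2); set a2 := E (~` J) a in A2 *.
have wE : w = a2 + r%:C%C *: refl_proj (E J v).
  have Ba : E J a = B v by exact: (opA_uniq hop (spectral_reduce hH hop hsa hd hE mJ Aa) (hB v)).
  have -> : w = a + C v by rewrite /a subrK.
  rewrite -{1}(spectral_C hH hE a mJ) Ba /trivop -/a2.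
  by apply: (eq_dotr hH) => x; rewrite !(rdotBr, rdotDr); ring.
have Ja2 : E (~` J) a2 = a2 := proj_idem (spectral_proj hE mC) a.
have JS : E J (refl_proj (E J v)) = refl_proj (E J v) by rewrite -refl_proj_comm (proj_idem (spectral_proj hE mJ)).
have CJ0 : ~` J `&` J = set0 by rewrite setICl.
have JC0 : J `&` ~` J = set0 by rewrite setICr.
have -> : rd w v = rd a2 v2 + r * rd (refl_proj (E J v)) (E J v).
  rewrite -[in LHS](spectral_C hH hE v mJ) -/v2 rdotDr wE !(rdotDl _ a2) !rdotZl.
  rewrite (spectral_orth mC mJ CJ0 Ja2 (proj_idem (spectral_proj hE mJ) v)).
  by rewrite (spectral_orth mJ mC JC0 JS v2C) mulr0 addr0 add0r addrC.
rewrite -pv -ev; congr (_ + _); rewrite {1}/refl_proj rdotBl.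
have -> : rd (P (E J v)) (E J v) = rd (P (E J v)) v by rewrite -(proj_sym hH (spectral_proj hE mJ)) JP.
have -> : rd (E J v - P (E J v)) (E J v) = rd (E J v - P (E J v)) v.
  by rewrite -(proj_sym hH (spectral_proj hE mJ)) (bopB bJ) JP (proj_idem (spectral_proj hE mJ)).
ring.
Qed.

End Trivializing.

(** * Norm continuity *)

Section NormContinuity.
Variables (R : realType) (H : completeNormedModType R[i]) (X : topologicalType).
Implicit Types F G : X -> H -> H.

Lemma opnorm_continuous_cst (T : H -> H) : bounded_op T -> opnorm_continuous (fun _ : X => T).
Proof.
move=> bT; apply/opnorm_continuousP; split => // x e e0; apply: nearW => y v.
by rewrite subrr rnorm0 mulr_ge0 ?rnorm_ge0// ltW.
Qed.

Lemma opnorm_continuousD F G : opnorm_continuous F -> opnorm_continuous G ->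
  opnorm_continuous (fun x v => F x v + G x v).
Proof.
move=> /opnorm_continuousP[bF cF] /opnorm_continuousP[bG cG].
apply/opnorm_continuousP; split=> [x|x e e0]; first exact: bop_add.
have e2 : 0 < e / 2 by rewrite divr_gt0.
apply: filterS2 (cF x _ e2) (cG x _ e2) => y hF hG v.
rewrite opprD addrACA (le_trans (rnormD _ _))// (le_trans (lerD (hF v) (hG v)))//.
by rewrite -mulrDl -splitr.
Qed.

Lemma opnorm_continuous_comp F G : opnorm_continuous F -> opnorm_continuous G ->
  opnorm_continuous (fun x v => F x (G x v)).
Proof.
move=> /opnorm_continuousP[bF cF] /opnorm_continuousP[bG cG].
apply/opnorm_continuousP; split=> [x|x e e0]; first exact: (bop_comp (bF x) (bG x)).
have [M M0 hM] := bop_bd (bF x); have [N N0 hN] := bop_bd (bG x).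
have M1 : 0 < M + 1 by rewrite ltr_wpDl.
have N1 : 0 < N + 1 by rewrite ltr_wpDl.
have e1 : 0 < e / 2 / (M + 1) by rewrite !divr_gt0.
have e2 : 0 < e / 2 / (N + 1) by rewrite !divr_gt0.
(* The tolerance 1 bounds F y by M + 1 near x; the other two control the terms of F y (G y - G x) +
   (F y - F x) G x. *)
apply: filterS3 (cF x _ ltr01) (cF x _ e2) (cG x _ e1) => y hF1 hF hG v.
have -> : F y (G y v) - F x (G x v) = F y (G y v - G x v) + (F y (G x v) - F x (G x v)).
  by rewrite (bopB (bF y)) addrA subrK.
have FM u : rnorm (F y u) <= (M + 1) * rnorm u.
  rewrite -(subrK (F x u) (F y u)) (le_trans (rnormD _ _))// mulrDl addrC lerD//.
  exact: hF1.
apply: (le_trans (rnormD _ _)); rewrite [e in leRHS]splitr mulrDl; apply: lerD.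
  apply: (le_trans (FM _)); rewrite mulrC -ler_pdivlMr//.
  by apply: le_trans (hG v) _; rewrite [leRHS]mulrAC.
apply: (le_trans (hF _)); apply: (@le_trans _ _ (e / 2 / (N + 1) * ((N + 1) * rnorm v))).
  rewrite ler_wpM2l ?(ltW e2)// (le_trans (hN v))// ler_wpM2r ?rnorm_ge0//.
  by rewrite lerDl.
by rewrite mulrA divfK// gt_eqF.
Qed.

Lemma opnorm_continuousZ (k : X -> R) F : continuous k -> opnorm_continuous F ->
  opnorm_continuous (fun x v => (k x)%:C%C *: F x v).
Proof.
move=> ck cF; apply: (opnorm_continuous_comp (F := fun x v => (k x)%:C%C *: v)) => //.
apply/opnorm_continuousP; split=> [x|x e e0]; first exact: bop_scale (bop_id H).
have /cvgrPdist_le/(_ e e0) := ck x; apply: filterS => y h v.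
by rewrite -scalerBl -rmorphB /= rnormZr distrC ler_wpM2r ?rnorm_ge0.
Qed.

Lemma opnorm_continuousB F G : opnorm_continuous F -> opnorm_continuous G ->
  opnorm_continuous (fun x v => F x v - G x v).
Proof.
move=> cF cG; have := opnorm_continuousD cF (opnorm_continuousZ (@cst_continuous X R (-1)) cG).
by congr opnorm_continuous; apply/funext => x; apply/funext => v; rewrite rmorphN scaleN1r.
Qed.

(** The operator version of [bern], with U for x and 1 - U for 1 - x. *)
Fixpoint bernop (U : H -> H) n (f : nat -> R) (v : H) : H :=
  if n is n'.+1
  then U (bernop U n' (f \o succn) v) + (bernop U n' f v - U (bernop U n' f v))
  else (f 0%N)%:C%C *: v.

Lemma bernop_eigen (U : H -> H) (x : R) v n f : bounded_op U -> U v = x%:C%C *: v ->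
  bernop U n f v = (bern x n f)%:C%C *: v.
Proof.
move=> bU Uv; elim: n f => [//|n IH] f /=.
rewrite !IH !(bopZ bU) Uv !scalerA -scalerBl -scalerDl; congr (_ *: _).
by rewrite -!rmorphM /= -rmorphB -rmorphD /=; congr (_%:C)%C; ring.
Qed.

Lemma bernop_continuous (U : X -> H -> H) n f : opnorm_continuous U ->
  opnorm_continuous (fun x => bernop (U x) n f).
Proof.
move=> cU; elim: n f => [|n IH] f /=.
  exact: opnorm_continuousZ (@cst_continuous X R _) (opnorm_continuous_cst (bop_id H)).
apply: opnorm_continuousD; first exact: opnorm_continuous_comp.
by apply: opnorm_continuousB => //; exact: opnorm_continuous_comp.
Qed.

End NormContinuity.

(** * Eigenvectors under the bounded transform and under the grading *)

Section Transform.
Variables (R : realType) (H : completeNormedModType R[i]) (dot : {dot H for Num.conj}).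
Hypothesis hH : is_hilbert dot.
Variables (A : set (H * H)).
Hypotheses (hop : is_operator A) (hsa : self_adjoint dot A).

(** S^2 v = c^2 v with c > 0, so [w] = S v - c v satisfies S w = - c w, and nonnegativity of S
    forces [w] to be zero. Then F v = A (S v) = c t v. *)
Lemma transform_eigen F t v : is_bounded_transform dot A F -> eigvec A t v ->
  F v = (btransform t)%:C%C *: v.
Proof.
move=> [S [bS _ S0 SS FE]] ev.
have t1 : 0 < 1 + t ^+ 2 by rewrite ltr_pwDl// sqr_ge0.
pose c := (Num.sqrt (1 + t ^+ 2))^-1.
have c0 : 0 < c by rewrite invr_gt0 sqrtr_gt0.
have c2 : c ^+ 2 * (1 + t ^+ 2) = 1.
  by rewrite /c exprVn sqr_sqrtr ?(ltW t1)// mulVf// gt_eqF.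
have SSv : S (S v) = (c ^+ 2)%:C%C *: v.
  have : graph (S \o S) ((1 + t ^+ 2)%:C%C *: v, v).
    rewrite SS /op_inv /=; exists v, ((t ^+ 2)%:C%C *: v); split => //=.
      exists (t%:C%C *: v); split => //.
      have := opAZ hop t%:C%C ev; rewrite hsa scalerA -rmorphM /= -expr2.
      exact.
    by rewrite rmorphD /= scalerDl scale1r.
  rewrite /graph /= !(bopZ bS) => e; rewrite {2}e scalerA -rmorphM /= c2 scale1r//.
have Sv : S v = c%:C%C *: v.
  pose w := S v - c%:C%C *: v.
  have Sw : S w = - (c%:C%C *: w).
    by rewrite /w (bopB bS) (bopZ bS) SSv scalerBr opprB scalerA -rmorphM /= -expr2 addrC.
  have : 0 <= rdot dot (S w) w by have := S0 w; rewrite lecE => /andP[].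
  rewrite Sw rdotNl rdotZl oppr_ge0 pmulr_rle0// => w0.
  apply/eqP; rewrite -subr_eq0; apply/eqP/(rdot_eq0 hH)/eqP.
  by rewrite eq_le w0 rdot_ge0.
have : op_comp A (graph S) (v, F v) by rewrite -FE.
move=> [u [/= + Au]]; rewrite /graph /= => uE; move: Au; rewrite uE Sv => h.
rewrite (opA_uniq hop h (opAZ hop c%:C%C ev)) scalerA -rmorphM /=.
by rewrite mulrC.
Qed.

End Transform.

Section Grading.
Variables (R : realType) (H : completeNormedModType R[i]) (dot : {dot H for Num.conj}).
Hypothesis hH : is_hilbert dot.
Variables (H0 H1 : set H) (sigma : H -> H).
Hypothesis hs : is_grading dot H0 H1 sigma.

Lemma grading_bop : bounded_op sigma.
Proof.
have [[z0 l0] [z1 l1] _ _ orth dec sym] := hs.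
apply/bounded_opP; split.
  move=> a u v; have [u0 [u1 [hu0 hu1 ->]]] := dec u; have [v0 [v1 [hv0 hv1 ->]]] := dec v.
  rewrite scalerDr addrACA !sym//; [|exact: l0|exact: l1].
  by rewrite scalerBr addrACA opprD.
exists 1 => // v; rewrite mul1r; have [v0 [v1 [h0 h1 ->]]] := dec v.
have o : rdot dot v0 v1 = 0 by rewrite /rdot orth.
by rewrite sym// (rnorm_sqr_le hH) !(rdotDl, rdotDr, rdotNl, rdotNr) (rdotC dot v1 v0) !o; lra.
Qed.

Lemma gradingK v : sigma (sigma v) = v.
Proof.
have [_ [z1 l1] _ _ _ dec sym] := hs; have [v0 [v1 [h0 h1 ->]]] := dec v.
have hN : H1 (- v1) by have := l1 (-1) _ _ h1 z1; rewrite addr0 scaleN1r.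
by rewrite sym// sym// opprK.
Qed.

Lemma odd_opP C : odd_op sigma (graph C) <-> forall v, C (sigma v) = - sigma (C v).
Proof.
split=> [oC v|oC].
  have : op_comp (graph C) (graph sigma) (v, C (sigma v)) by exists (sigma v).
  by rewrite oC => -[u [/= + /=]]; rewrite /graph /= => -> <-; rewrite opprK.
apply/seteqP; split=> -[v w] [u [/=]]; rewrite /graph /= => ->.
  by move=> ->; exists (C v); split => //=; rewrite /graph /= oC opprK.
by move=> h; exists (sigma v); split => //=; rewrite /graph /= oC -h opprK.
Qed.

Lemma odd_eigvec A t v : odd_op sigma A -> eigvec A t v -> eigvec A (- t) (sigma v).
Proof.
move=> oA ev; have : op_comp A (graph sigma) (v, (- t)%:C%C *: sigma v).
  rewrite oA; exists (t%:C%C *: v); split => //=.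
  by rewrite /graph /= (bopZ grading_bop) rmorphN scaleNr opprK.
by move=> [u [/= + h]]; rewrite /graph /= => uE; move: h; rewrite uE; exact.
Qed.

End Grading.

Lemma clampN (R : realType) (a t : R) : 0 <= a -> clamp a (- t) = - clamp a t.
Proof.
by move=> a0; case: (clampP t a0) => -[ht ->]; case: (clampP (- t) a0) => -[ht' ->]; lra.
Qed.

(** * The operator at one point, and the assembled family *)

Section LocalConstruction.
Variables (R : realType) (H : completeNormedModType R[i]) (dot : {dot H for Num.conj}).
Hypothesis hH : is_hilbert dot.
Variables (H0 H1 : set H) (sigma : H -> H) (A : set (H * H)) (r : R) (P : H -> H) (E : set R -> H -> H).
Hypotheses (hs : is_grading dot H0 H1 sigma) (hA : RK1 dot sigma A) (r0 : 0 < r).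
Hypotheses (pP : projection dot P) (hE : is_spectral_measure dot A E).
Hypothesis leP1 : op_le dot (E `[r, +oo[%classic) P.
Hypothesis leP2 : op_le dot P (E `]- r, +oo[%classic).
Hypothesis oP : forall v, sigma (P (sigma v)) = v - P v.

(** The last clause identifies r (2P - 1) - C with clamp_r(A) on eigenvectors; continuity of the
    family will rest on it. *)
Lemma trivializing_local : exists C : H -> H,
  [/\ B1 dot sigma C, trivializing dot r A C,
      exists2 E', is_spectral_measure dot (op_add A (graph C)) E' & P = E' `[0, +oo[%classic,
      opnorm C < 2 * r &
      forall t v, eigvec A t v -> r%:C%C *: refl_proj P v - C v = (clamp r t)%:C%C *: v].
Proof.
have [[[hop hcl hd] hsa hK] oA] := hA.
have [B hB] := A_on_J hH hE r.
exists (trivop E r P B).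
have bC : bounded_op (trivop E r P B) by exact: (bop_trivop hH hop hsa hd hK hE r0 pP hB).
have sC : self_adjoint dot (graph (trivop E r P B)).
  apply: (rsym_sa hH bC) => u v; exact: (trivop_sym hH hop hsa hd hE r0 pP leP1 leP2 hB).
have cl t v (h : eigvec A t v) : r%:C%C *: refl_proj P v - trivop E r P B v = (clamp r t)%:C%C *: v.
  exact: (trivop_clamp hH hop hsa hd hK hE r0 pP leP1 leP2 hB h).
have bs := grading_bop hH hs.
split => //.
(* The bounded operator C sigma + sigma C is shown to vanish on eigenvectors: sigma exchanges
   eigenvalues t and -t, the clamp is odd, and sigma anticommutes with 2P - 1. *)
- split => //; apply/odd_opP => v; apply/eqP; rewrite -addr_eq0; apply/eqP.
  have bT := bop_add (bop_comp bC bs) (bop_comp bs bC).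
  apply: (eigen_ext hH hop hsa hd hK hE bT) => t {}v ev /=.
  have C1 : trivop E r P B v = r%:C%C *: refl_proj P v - (clamp r t)%:C%C *: v by rewrite -(cl _ _ ev) subKr.
  have := cl _ _ (odd_eigvec hH hs oA ev); rewrite clampN ?(ltW r0)// rmorphN scaleNr => C2.
  have {}C2 : trivop E r P B (sigma v) = r%:C%C *: refl_proj P (sigma v) + (clamp r t)%:C%C *: sigma v.
    by rewrite -[_ *: sigma v]opprK -C2 subKr.
  have sP : refl_proj P (sigma v) = - sigma (refl_proj P v).
    have PE : P (sigma v) = sigma (v - P v) by rewrite -oP (gradingK hs).
    by rewrite /refl_proj PE !(bopB bs) opprB !opprB; apply: (eq_dotr hH) => w; rewrite !(rdotBr, rdotDr); ring.
  rewrite C1 C2 sP; move: (refl_proj P v) => p; rewrite (bopB bs) !(bopZ bs) scalerN.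
  by apply: (eq_dotr hH) => w; rewrite !(rdotBr, rdotDr, rdotNr, rdot0r); ring.
- split => //.
  + exact: (trivop_finite hH hop hsa hd hK hE r0 pP leP1 leP2 hB).
  + exact: (trivop_sum_invertible hH hop hsa hd hcl hK hE r0 pP leP1 leP2 hB).
  + by exists E => //; exact: (trivop_range hH hop hsa hd hE r0 pP leP1 leP2 hB).
- exists (trivop_measure E r P); last exact: (trivop_measure_ge0 hH hE r0 pP leP1 leP2).
  exact: (trivop_spectral hH hop hsa hd hK hE r0 pP leP1 leP2 hB).
- exact: (trivop_norm hH hop hsa hd hK hE r0 pP hB).
Qed.

End LocalConstruction.

Theorem theorem6p8 (R : realType) (H : completeNormedModType R[i])
    (dot : {dot H for Num.conj}) (H0 H1 : set H) (sigma : H -> H)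
    (hH : is_hilbert dot) (hsep : separable_space H)
    (hsigma : is_grading dot H0 H1 sigma)
    (hH0 : ~ finite_dimensional H0) (hH1 : ~ finite_dimensional H1)
    (X : topologicalType) (A : X -> set (H * H))
    (hA : forall x, RK1 dot sigma (A x)) (hAc : Riesz_continuous dot A)
    (r : X -> R) (hr : forall x, 0 < r x) (hrc : continuous r)
    (P : X -> H -> H) (hP : Cl1_spectral_section dot sigma A r P) :
  exists C : X -> H -> H,
    [/\ forall x, B1 dot sigma (C x),
        trivializing_family dot A r C,
        agrees_with dot A C P &
        forall x, opnorm (C x) < 2 * r x].
Proof.
have [[cP pP sP] oP] := hP.
have loc x : exists C : H -> H,
  [/\ B1 dot sigma C, trivializing dot (r x) (A x) C,
      exists2 E', is_spectral_measure dot (op_add (A x) (graph C)) E' & P x = E' `[0, +oo[%classic,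
      opnorm C < 2 * r x &
      forall t v, eigvec (A x) t v ->
        (r x)%:C%C *: refl_proj (P x) v - C v = (clamp (r x) t)%:C%C *: v].
  have [E hE [le1 le2]] := sP x.
  exact: (trivializing_local hH hsigma (hA x) (hr x) (pP x) hE le1 le2 (oP x)).
(* The operators are chosen independently at each x. Continuity is still provable because the
   eigenvector clause determines each of them. *)
have [C hC] := boolp.choice loc; exists C; split; last 2 first.
- by move=> x; have [_ _ h _ _] := hC x.
- by move=> x; have [_ _ _ h _] := hC x.
- by move=> x; have [h _ _ _ _] := hC x.
split; last by move=> x; have [_ h _ _ _] := hC x.
have cS : opnorm_continuous (fun x => refl_proj (P x)).
  apply: opnorm_continuousB => //; apply: opnorm_continuousB => //.
  exact: opnorm_continuous_cst (bop_id H).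
pose Cl x v := (r x)%:C%C *: refl_proj (P x) v - C x v.
suff cCl : opnorm_continuous Cl.
  have := opnorm_continuousB (opnorm_continuousZ hrc cS) cCl.
  by congr opnorm_continuous; apply/funext => x; apply/funext => v; rewrite /Cl subKr.
have bCl x : bounded_op (Cl x).
  apply: bop_sub; last by have [[]] := hC x.
  by apply: bop_scale; case: cS.
have [F hF cF] := hAc.
pose U x v := 2^-1%:C%C *: (v + F x v).
have cU : opnorm_continuous U.
  apply: opnorm_continuousZ (@cst_continuous X R _) _.
  by apply: opnorm_continuousD => //; exact: opnorm_continuous_cst (bop_id H).
apply/opnorm_continuousP; split => // x e e0.
(* Four errors: the approximation at y and at x, the change of the cut-off from r x to r y, and the
   change of the Bernstein polynomial of U. *)
have e4 : 0 < e / 4 by rewrite divr_gt0.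
have [n [f hf]] := clamp_approx (ltW (hr x)) e4.
have [_ cB] := (opnorm_continuousP _).1 (bernop_continuous n f cU).
(* The polynomial approximates the clamp at level r x, also when it is evaluated at y; hence the
   extra term. *)
have close y v : rnorm (Cl y v - bernop (U y) n f v) <= (e / 4 + `|r y - r x|) * rnorm v.
  have [[[hop hcl hd] hsa hK] _] := hA y; have [E hE _] := sP y.
  have bB := bop_sub (bCl y) ((bernop_continuous n f cU).1 y).
  apply: (eigen_bound hH hop hsa hd hK hE (g := fun t => clamp (r y) t - bern ((1 + btransform t) / 2) n f) bB).
  - by rewrite addr_ge0// ltW.
  - move=> t {}v ev; have [_ _ _ _ h] := hC y.
    have Uv : U y v = ((1 + btransform t) / 2)%:C%C *: v.
      rewrite /U (transform_eigen hH hop hsa (hF y) ev) -[X in X + _]scale1r -scalerDl scalerA.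
      by rewrite mulrC [in RHS]rmorphM rmorphD.
    rewrite /Cl (h _ _ ev) (bernop_eigen n f (cU.1 y) Uv) -scalerBl.
    by rewrite rmorphB.
  move=> t; have h1 := hf t; have h2 := clamp_lip_cutoff t (ltW (hr y)) (ltW (hr x)).
  rewrite -(subrKA (clamp (r x) t)) (le_trans (ler_normD _ _))// addrC lerD//.
  by rewrite distrC.
have /cvgrPdist_le/(_ _ e4) cr := hrc x.
apply: filterS2 cr (cB x _ e4) => y hry hB v.
have tele (a b p q : H) : a - b = (a - p) + (p - q) - (b - q).
  by rewrite subrKA opprB subrKA.
rewrite (tele _ _ (bernop (U y) n f v) (bernop (U x) n f v)).
have h1 := close y v; have h2 := close x v; rewrite subrr normr0 addr0 in h2.
have h3 : `|r y - r x| * rnorm v <= e / 4 * rnorm v by rewrite distrC ler_wpM2r ?rnorm_ge0.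
apply: (le_trans (rnormB _ _)); apply: (le_trans (lerD (rnormD _ _) (lexx _))).
by rewrite mulrDl in h1; have := hB v; move: h1 h2 h3; lra.
Qed.
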